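(* Let $a\in B^*_{-1}$ (a space of ultradistributions on $\mathbb R^{2d}$) be such that $b(x,\xi)=\pi^{-d}\left(a(\cdot,\cdot)*e^{-|\cdot|^2-|\cdot|^2}\right)(x,\xi)$ satisfies the following condition: for every compact $K\subset\mathbb R^d_x$ there exists $\tilde r>0$ such that there exist $m,C_1>0$ with $$|b(x+i\eta,\xi)|\le C_1e^{M(m|\xi|)},\qquad x\in K,\ |\eta|<\tilde r,\ \xi\in\mathbb R^d,$$ in the $(M_p)$ case, resp. there exist $C_1>0$ and $(k_p)\in\mathfrak R$ with $$|b(x+i\eta,\xi)|\le C_1e^{N_{k_p}(|\xi|)},\qquad x\in K,\ |\eta|<\tilde r,\ \xi\in\mathbb R^d,$$ in the $\{M_p\}$ case (in both cases $C_1$ and $m$, resp. $C_1$ and $(k_p)$, may depend on $K$). Then, for every $\chi\in\mathcal D^*(\mathbb R^{2d})$, $$\langle K_b,\chi\rangle=\frac1{(2\pi)^d}\int_{\mathbb R^d}\int_{\mathbb R^d}\int_{\mathbb R^d}e^{i(x-y)\xi}\,b\left(\frac{x+y}2,\xi\right)\chi(x,y)\,dx\,dy\,d\xi$$ is well defined as an oscillatory integral, and the $K_b$ so defined is a well defined ultradistribution, i.e. $K_b\in\mathcal D'^*(\mathbb R^{2d})$.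
   Context: $D_j=i^{-1}\partial_j$; $M_\alpha:=M_{|\alpha|}$ for multi-indices $\alpha$. $(M_p)_{p\in\mathbb N}$ is a sequence of positive numbers with $M_0=1$ satisfying, for some constants $c_0,H\ge1$: (M.1) $M_p^2\le M_{p-1}M_{p+1}$, $p\ge1$; (M.2) $M_p\le c_0H^p\min_{0\le q\le p}M_{p-q}M_q$; (M.3) $\sum_{p=q+1}^\infty M_{p-1}/M_p\le c_0\,qM_q/M_{q+1}$, $q\ge1$. $M(t)=\sup_p\log_+(t^p/M_p)$, $t>0$ ($M(0)=0$). $\mathfrak R$ is the set of positive sequences monotonically increasing to infinity, and for $(k_p)\in\mathfrak R$, $N_{k_p}(t)=\sup_p\log_+\frac{t^p}{M_p\prod_{j=1}^pk_j}$, $t>0$ ($N_{k_p}(0)=0$). The symbol $*$ stands for either $(M_p)$ (Beurling) or $\{M_p\}$ (Roumieu); the statement is asserted in each case. For compact $K\subset\mathbb R^n$ and $h>0$, $\mathcal D^{\{M_p\},h}_K$ is the Banach space of $\varphi\in C^\infty(\mathbb R^n)$ supported in $K$ with $\sup_{\alpha}\sup_{x\in K}|D^\alpha\varphi(x)|/(h^{|\alpha|}M_\alpha)<\infty$; $\mathcal D^{(M_p)}(\mathbb R^n)=\varinjlim_K\varprojlim_{h\to0}\mathcal D^{\{M_p\},h}_K$, $\mathcal D^{\{M_p\}}(\mathbb R^n)=\varinjlim_K\varinjlim_{h\to\infty}\mathcal D^{\{M_p\},h}_K$; $\mathcal D'^*$ is the strong dual of $\mathcal D^*$. $\mathcal S^{M_p,m}_\infty(\mathbb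 R^n)$ is the Banach space of smooth $\varphi$ with $\sup_\alpha m^{|\alpha|}\|e^{M(m|\cdot|)}D^\alpha\varphi\|_{L^\infty}/M_\alpha<\infty$; $\mathcal S^{(M_p)}=\varprojlim_{m\to\infty}\mathcal S^{M_p,m}_\infty$, $\mathcal S^{\{M_p\}}=\varinjlim_{m\to0}\mathcal S^{M_p,m}_\infty$; $\mathcal S'^*$ is the strong dual of $\mathcal S^*$. With $n=2d$ and $X=(x,\xi)\in\mathbb R^{2d}$: $B^*=\{S\in\mathcal D'^*(\mathbb R^{2d}):\cosh(k|X|)S\in\mathcal S'^*(\mathbb R^{2d})\ \forall k\ge0\}$ and $B^*_{-1}=e^{|X|^2}B^*$. It is known that for $a\in\mathcal D'^*(\mathbb R^{2d})$ the convolution $a*e^{-|\cdot|^2}$ (Gaussian on $\mathbb R^{2d}$, i.e. $e^{-|x|^2-|\xi|^2}$) exists in the sense of ultradistributions iff $a\in B^*_{-1}$, and then it equals $$\left(a*e^{-|\cdot|^2-|\cdot|^2}\right)(x,\xi)=e^{-|x|^2-|\xi|^2}\,\mathcal L\left(e^{-|\cdot|^2-|\cdot|^2}a\right)(-2x,-2\xi),$$ where $\mathcal L(S)(\zeta)$, $\zeta=u+iv\in\mathbb C^{2d}$, denotes the Laplace transform $\mathcal F_{X\to v}(e^{-X\cdot u}S(X))$ (with $(\mathcal Ff)(v)=\int e^{-iX\cdot v}f(X)\,dX$), which is entire for $S\in B^*$. Hence $b$ extends to an entire function on $\mathbb C^{2d}$, and $b(x+i\eta,\xi)$ denotes the value of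 this extension. ''Well defined as an oscillatory integral'' means: for $\psi\in\mathcal D^*(\mathbb R^d)$ with $\psi=1$ in a neighborhood of $0$, the limit as $\delta\to0^+$ of $$\frac1{(2\pi)^d}\int_{\mathbb R^{3d}}e^{i(x-y)\xi}\psi(\delta\xi)\,b\left(\frac{x+y}2,\xi\right)\chi(x,y)\,dx\,dy\,d\xi$$ exists for every $\chi\in\mathcal D^*(\mathbb R^{2d})$ and does not depend on $\psi$; this limit is the value of the integral. *)

(* Defs.v *)
From HB Require Import structures.
From mathcomp Require Import all_boot all_order all_algebra.
From mathcomp Require Import all_classical all_reals all_analysis.
From mathcomp Require Import complex.
Set Implicit Arguments. Unset Strict Implicit. Unset Printing Implicit Defensive.
Import Order.TTheory GRing.Theory Num.Theory.
Import numFieldNormedType.Exports.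
Local Open Scope classical_set_scope.
Local Open Scope ring_scope.

Definition measure_rV_display : measure_display. Proof. exact: default_measure_display. Qed.

Section measurable_rV.
Variables (R : realType) (n : nat).

Let coord_rV (i : 'I_n) (x : 'rV[R]_n) : measurableTypeR R := x 0 i.

Let rV_set0 : g_sigma_preimage coord_rV set0.
Proof. exact: sigma_algebra0. Qed.

Let rV_setC A : g_sigma_preimage coord_rV A -> g_sigma_preimage coord_rV (~` A).
Proof. exact: sigma_algebraC. Qed.

Let rV_bigcup (F : _^nat) : (forall i, g_sigma_preimage coord_rV (F i)) ->
  g_sigma_preimage coord_rV (\bigcup_i (F i)).
Proof. exact: sigma_algebra_bigcup. Qed.

HB.instance Definition _ := @isMeasurable.Build measure_rV_display
  'rV[R]_n (g_sigma_preimage coord_rV) rV_set0 rV_setC rV_bigcup.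

Lemma measurable_coord_rV (i : 'I_n) :
  measurable_fun [set: 'rV[R]_n] (fun x => x 0 i : measurableTypeR R).
Proof.
move=> _ Y mY; rewrite setTI; apply: sub_sigma_algebra => /=.
rewrite -bigcup_seq/=; exists i => /=; first by rewrite mem_index_enum.
by exists Y => //; rewrite setTI.
Qed.

Lemma measurable_fun_rV d (T : measurableType d) (f : T -> 'rV[R]_n) :
  (forall i, measurable_fun setT (fun t => f t 0 i : measurableTypeR R)) ->
  measurable_fun setT f.
Proof.
move=> mf.
suff fS : g_sigma_preimage coord_rV `<=` [set B | measurable (f @^-1` B)].
  by move=> _ B mB; rewrite setTI; exact: fS.
apply: smallest_sub.
  split.
  - by rewrite /= preimage_set0.
  - by move=> B /= mB; rewrite setTD -preimage_setC; exact: measurableC.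
  - by move=> B /= mB; rewrite preimage_bigcup; exact: bigcup_measurable.
rewrite -bigcup_seq/=; apply: bigcup_sub => i _ _ [B mB <-].
by rewrite /= setTI -comp_preimage -[X in measurable X]setTI; exact: mf.
Qed.

End measurable_rV.

Section lebesgue_rV.
Variable R : realType.

Definition rV_cons n (p : measurableTypeR R * 'rV[R]_n) : 'rV[R]_n.+1 :=
  \row_j oapp (fun k => p.2 0 k) p.1 (unlift 0 j).

Definition rV_uncons n (x : 'rV[R]_n.+1) : measurableTypeR R * 'rV[R]_n :=
  (x 0 0, \row_k x 0 (lift 0 k)).

Lemma rV_consK n : cancel (@rV_cons n) (@rV_uncons n).
Proof.
case=> t x; rewrite /rV_uncons mxE unlift_none; congr pair.
by apply/rowP => k; rewrite !mxE liftK.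
Qed.

Lemma measurable_rV_cons n : measurable_fun setT (@rV_cons n).
Proof.
apply: measurable_fun_rV => i; under eq_fun do rewrite mxE.
case: unliftP => [k _|_] /=; last exact: measurable_fst.
by apply: (measurableT_comp (measurable_coord_rV k)); exact: measurable_snd.
Qed.

Lemma measurable_rV_uncons n : measurable_fun setT (@rV_uncons n).
Proof.
apply: measurable_fun_pair; first exact: measurable_coord_rV.
apply: measurable_fun_rV => i; under eq_fun do rewrite mxE.
exact: measurable_coord_rV.
Qed.

HB.instance Definition _ n :=
  isMeasurableFun.Build _ _ _ _ (@rV_cons n) (@measurable_rV_cons n).

Section step.
Variables (n : nat) (m : {sigma_finite_measure set 'rV[R]_n -> \bar R}).

Definition lebesgue_rV_step : set 'rV[R]_n.+1 -> \bar R :=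
  pushforward (@lebesgue_measure R \x m)%E (@rV_cons n).


Let step0 : lebesgue_rV_step set0 = 0%E.
Proof. by rewrite /lebesgue_rV_step /pushforward preimage_set0 measure0. Qed.

Let step_ge0 A : (0 <= lebesgue_rV_step A)%E.
Proof. exact: measure_ge0. Qed.

Let step_sigma_additive : semi_sigma_additive lebesgue_rV_step.
Proof.
exact: measure_semi_sigma_additive.
Qed.

HB.instance Definition _ := isMeasure.Build _ _ _ lebesgue_rV_step
  step0 step_ge0 step_sigma_additive.

Let step_sigma_finite : sigma_finite setT lebesgue_rV_step.
Proof.
have /sigma_finiteP[F [TF ndF Foo]] := sigma_finiteT (@lebesgue_measure R).
have /sigma_finiteP[G [TG ndG Goo]] := sigma_finiteT m.
exists (fun k => @rV_uncons n @^-1` (F k `*` G k)) => [|k].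
  apply/esym; rewrite -subTset => x _.
  have [i _ Fi] : (\bigcup_k F k) (rV_uncons x).1 by rewrite -TF.
  have [j _ Gj] : (\bigcup_k G k) (rV_uncons x).2 by rewrite -TG.
  exists (maxn i j) => //; split.
    by move: Fi; exact/subsetPset/ndF/leq_maxl.
  by move: Gj; exact/subsetPset/ndG/leq_maxr.
have [mF Fk] := Foo k; have [mG Gk] := Goo k.
have mFG : measurable (F k `*` G k) by exact: measurableX.
split; first by rewrite -[X in measurable X]setTI; exact: measurable_rV_uncons.
rewrite /lebesgue_rV_step /pushforward -comp_preimage (_ : _ \o _ = id).
  by rewrite preimage_id product_measure1E// lte_mul_pinfty// ge0_fin_numE.
by apply/funext => p /=; rewrite rV_consK.
Qed.

HB.instance Definition _ := Measure_isSigmaFinite.Build _ _ _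
  lebesgue_rV_step step_sigma_finite.

End step.

Fixpoint lebesgue_rV n : {sigma_finite_measure set 'rV[R]_n -> \bar R} :=
  if n is n'.+1 then lebesgue_rV_step (lebesgue_rV n') else \d_(0 : 'rV[R]_0).

End lebesgue_rV.

Section complex_valued.
Variable R : realType.

(* R[i] itself carries no topology; typed as a numClosedFieldType it inherits
   the canonical one, hence the notions [continuous], [differentiable], [-->]. *)
Definition Cplx : numClosedFieldType := R[i].

Definition imC : Cplx := (0 +i* 1)%C.

Definition modC (z : Cplx) : R := Normc.normc z.

Definition cexp (z : Cplx) : Cplx :=
  ((expR (complex.Re z))%:C * (cos (complex.Im z) +i* sin (complex.Im z)))%C.

Definition cintegral d (T : measurableType d) (mu : {measure set T -> \bar R})
    (f : T -> Cplx) : Cplx :=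
  (Rintegral mu setT (fun x => complex.Re (f x)) +i*
   Rintegral mu setT (fun x => complex.Im (f x)))%C.

Definition cintegrable d (T : measurableType d)
    (mu : {measure set T -> \bar R}) (f : T -> Cplx) : Prop :=
  mu.-integrable setT (fun x => (complex.Re (f x))%:E) /\
  mu.-integrable setT (fun x => (complex.Im (f x))%:E).

Definition coshR (t : R) : R := (expR t + expR (- t)) / 2.

Variable n : nat.

(* The norm of the library on row vectors is the sup norm. *)
Definition enorm (x : 'rV[R]_n) : R := Num.sqrt (\sum_j x 0 j ^+ 2).

Definition dotr (x y : 'rV[R]_n) : R := \sum_j x 0 j * y 0 j.

Definition cvec (u v : 'rV[R]_n) : 'rV[Cplx]_n := \row_j (u 0 j +i* v 0 j)%C.

Definition entire (f : 'rV[Cplx]_n -> Cplx) : Prop :=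
  forall z, differentiable f z.

Definition cfun := 'rV[R]_n -> Cplx.

Definition partialC (j : 'I_n) (f : cfun) : cfun := fun x =>
  ('D_(delta_mx 0 j) (fun y => complex.Re (f y)) x +i*
   'D_(delta_mx 0 j) (fun y => complex.Im (f y)) x)%C.

Definition smooth (f : cfun) : Prop := forall s : seq 'I_n,
  let g := foldr partialC f s in
  continuous g /\ forall x j,
    derivable (fun y => complex.Re (g y)) x (delta_mx 0 j) /\
    derivable (fun y => complex.Im (g y)) x (delta_mx 0 j).

Definition mindex := {ffun 'I_n -> nat}.

Definition mlen (a : mindex) : nat := (\sum_j a j)%N.

Definition Dj (j : 'I_n) (f : cfun) : cfun := fun x => imC^-1 * partialC j f x.

Definition Dmulti (a : mindex) (f : cfun) : cfun :=
  foldr (fun j g => iter (a j) (Dj j) g) f (enum 'I_n).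

End complex_valued.

Section weight_sequences.
Variable R : realType.
Implicit Types M k : nat -> R.

Definition cond_M1 M := forall p, (1 <= p)%N -> M p ^+ 2 <= M p.-1 * M p.+1.

Definition cond_M2 M (c0 H : R) :=
  forall p q, (q <= p)%N -> M p <= c0 * H ^+ p * (M (p - q)%N * M q).

Definition cond_M3 M (c0 : R) := forall q, (1 <= q)%N ->
  (\sum_(q.+1 <= p <oo) (M p.-1 / M p)%:E <= (c0 * (q%:R * M q / M q.+1))%:E)%E.

Definition weight_sequence M : Prop :=
  [/\ forall p, 0 < M p, M 0%N = 1, cond_M1 M &
   exists c0 H : R, [/\ 1 <= c0, 1 <= H, cond_M2 M c0 H & cond_M3 M c0]].

Definition logp (x : R) : R := Num.max 0 (ln x).

(* The supremum is finite for the sequences considered here, since (M.3) forces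
   M p.-1 / M p to be summable. *)
Definition assoc_fun M (t : R) : R := sup [set logp (t ^+ p / M p) | p in setT].

Definition incr_to_infty k : Prop :=
  [/\ forall p, 0 < k p, {homo k : p q / (p <= q)%N >-> p <= q} &
      k @ \oo --> +oo].

Definition assoc_fun_k M k (t : R) : R :=
  assoc_fun (fun p => M p * \prod_(1 <= j < p.+1) k j) t.

End weight_sequences.

(* A locally convex space of functions: the underlying set of functions and the
   neighbourhoods of 0.  Only the trace of a neighbourhood on the carrier is
   meaningful. *)
Section locally_convex.
Variables (R : realType) (n : nat).
Local Notation F := (cfun R n).

Record lcs := Lcs { carrier : set F ; nbhs0 : set (set F) }.

Definition normed_lcs (A : set F) (p : F -> \bar R) : lcs := Lcs
  [set f | A f /\ (p f < +oo)%E]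
  [set U | exists2 e : R, 0 < e & forall f, A f -> (p f < e%:E)%E -> U f].

Definition proj_lim (I : eqType) (P : set I) (E : I -> lcs) : lcs := Lcs
  (\bigcap_(i in P) carrier (E i))
  [set U | exists (s : seq I) (V : I -> set F),
     (forall i, i \in s -> P i /\ nbhs0 (E i) (V i)) /\
     (forall f, (\bigcap_(i in P) carrier (E i)) f ->
        (forall i, i \in s -> V i f) -> U f)].

Definition abs_convex (V : set F) : Prop := forall f g (a b : Cplx R),
  V f -> V g -> modC a + modC b <= 1 -> V (fun x => a * f x + b * g x).

Definition ind_lim (I : Type) (P : set I) (E : I -> lcs) : lcs := Lcs
  (\bigcup_(i in P) carrier (E i))
  [set U | exists V : set F, [/\ abs_convex V, V `<=` U &
     forall i, P i -> nbhs0 (E i) (V `&` carrier (E i))]].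

(* Functionals are total functions on all functions; only their values on the
   carrier are meaningful. *)
Definition dual (E : lcs) (T : F -> Cplx R) : Prop :=
  (forall f g (a : Cplx R), carrier E f -> carrier E g ->
     T (fun x => a * f x + g x) = a * T f + T g) /\
  (forall e : R, 0 < e -> nbhs0 E [set f | modC (T f) < e]).

Definition mulU (g : F) (T : F -> Cplx R) : F -> Cplx R :=
  fun f => T (fun x => g x * f x).

End locally_convex.

Inductive regime := Beurling | Roumieu.

Section ultradistributions.
Variables (R : realType) (reg : regime) (M : nat -> R) (n : nat).
Local Notation F := (cfun R n).
Local Notation C := (Cplx R).

Definition D_norm (K : set 'rV[R]_n) (h : R) (f : F) : \bar R :=
  ereal_sup [set ereal_sup
    [set (modC (Dmulti a f x) / (h ^+ mlen a * M (mlen a)))%:E | x in K]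
  | a in [set: mindex n]].

Definition D_step (K : set 'rV[R]_n) (h : R) : lcs R n :=
  normed_lcs [set f : F | smooth f /\ closure [set x | f x != 0] `<=` K]
    (D_norm K h).

Definition D_space : lcs R n :=
  ind_lim (@compact _) (fun K => match reg with
    | Beurling => proj_lim [set h : R | 0 < h] (D_step K)
    | Roumieu => ind_lim [set h : R | 0 < h] (D_step K)
    end).

Definition S_norm (m : R) (f : F) : \bar R :=
  ereal_sup [set ((m ^+ mlen a)%:E *
    Lnorm (lebesgue_rV R n) +oo%E
      (fun x => (expR (assoc_fun M (m * enorm x)) * modC (Dmulti a f x))%:E) *
    ((M (mlen a))^-1)%:E)%E | a in [set: mindex n]].

Definition S_space : lcs R n := match reg with
  | Beurling => proj_lim [set m : R | 0 < m]
                  (fun m => normed_lcs (@smooth R n) (S_norm m))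
  | Roumieu => ind_lim [set m : R | 0 < m]
                  (fun m => normed_lcs (@smooth R n) (S_norm m))
  end.

Definition ultradistribution : set (F -> C) := dual D_space.

Definition tempered : set (F -> C) := dual S_space.

Definition eqD (T U : F -> C) : Prop := forall f, carrier D_space f -> T f = U f.

(* S'^* is a subspace of D'^* by restriction of functionals. *)
Definition in_tempered (U : F -> C) : Prop := exists2 T, tempered T & eqD T U.

Definition B_space (S : F -> C) : Prop := ultradistribution S /\
  forall k : R, 0 <= k ->
    in_tempered (mulU (fun X => (coshR (k * enorm X))%:C%C) S).

Definition Bm1_space (a : F -> C) : Prop := ultradistribution a /\
  exists2 S, B_space S & eqD a (mulU (fun X => (expR (enorm X ^+ 2))%:C%C) S).

Definition fourier (f : F) : F := fun v =>
  cintegral (lebesgue_rV R n)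
    (fun x => cexp (- (imC R * (dotr x v)%:C%C)) * f x).

(* L (u + i v) = F_{X -> v} (e^{- X . u} S(X)) for all u, where the Fourier
   transform on S'^* is the transpose of the one on S^*, and L (u + i .) is
   identified with the ultradistribution it defines. *)
Definition laplace_transform (S : F -> C) (L : 'rV[C]_n -> C) : Prop :=
  entire L /\ forall u : 'rV[R]_n, exists T : F -> C,
    [/\ tempered T,
        eqD T (mulU (fun X => (expR (- dotr X u))%:C%C) S) &
        eqD (fun f => T (fourier f))
            (fun f => cintegral (lebesgue_rV R n)
                        (fun v => L (cvec u v) * f v))].

(* g = a * e^{-|.|^2}, through the formula
   e^{-|X|^2} L(e^{-|.|^2} a)(-2 X) which holds whenever a is in [Bm1_space],
   i.e. exactly when the convolution exists. *)
Definition gauss_convolution (a : F -> C) (g : F) : Prop :=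
  exists2 L, laplace_transform (mulU (fun X => (expR (- enorm X ^+ 2))%:C%C) a) L
    & forall X, g X = (expR (- enorm X ^+ 2))%:C%C * L (cvec (- 2 *: X) 0).

End ultradistributions.

Section weyl_kernel.
Variables (R : realType) (reg : regime) (M : nat -> R) (d : nat).
Local Notation C := (Cplx R).

(* b is a function on C^(2d), evaluated here at (x + i eta, xi). *)
Definition at_strip (b : 'rV[C]_(d + d) -> C) (x eta xi : 'rV[R]_d) : C :=
  b (cvec (row_mx x xi) (row_mx eta 0)).

Definition growth_condition (b : 'rV[C]_(d + d) -> C) : Prop :=
  forall K : set 'rV[R]_d, compact K -> exists2 r : R, 0 < r &
  match reg with
  | Beurling => exists m C1 : R, [/\ 0 < m, 0 < C1 &
      forall x eta xi, K x -> enorm eta < r ->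
        modC (at_strip b x eta xi) <= C1 * expR (assoc_fun M (m * enorm xi))]
  | Roumieu => exists (C1 : R) (k : nat -> R), [/\ 0 < C1, incr_to_infty k &
      forall x eta xi, K x -> enorm eta < r ->
        modC (at_strip b x eta xi) <= C1 * expR (assoc_fun_k M k (enorm xi))]
  end.

(* R^(3d) is R^(2d) x R^d, the first factor being that of (x, y). *)
Definition osc_integrand (b : 'rV[C]_(d + d) -> C) (chi : cfun R (d + d))
    (psi : cfun R d) (delta : R) (p : 'rV[R]_(d + d) * 'rV[R]_d) : C :=
  let x := lsubmx p.1 in let y := rsubmx p.1 in let xi := p.2 in
  cexp (imC R * (dotr (x - y) xi)%:C%C) * psi (delta *: xi) *
  at_strip b (2^-1 *: (x + y)) 0 xi * chi (row_mx x y).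

Definition osc_measure : {measure set ('rV[R]_(d + d) * 'rV[R]_d) -> \bar R} :=
  (lebesgue_rV R (d + d) \x lebesgue_rV R d)%E.

(* l is the value of the oscillatory integral
   (2 pi)^(-d) int e^{i (x - y) xi} b((x + y) / 2, xi) chi(x, y) dx dy dxi. *)
Definition osc_integral (b : 'rV[C]_(d + d) -> C) (chi : cfun R (d + d)) (l : C)
    : Prop :=
  forall psi : cfun R d, carrier (D_space reg M d) psi ->
  (\forall xi \near (0 : 'rV[R]_d), psi xi = 1) ->
  (forall delta, 0 < delta ->
     cintegrable osc_measure (osc_integrand b chi psi delta)) /\
  (fun delta : R => (((2 * pi) ^+ d)^-1)%:C%C *
     cintegral osc_measure (osc_integrand b chi psi delta)) @ 0^'+ --> l.

End weyl_kernel.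

(* Main.v *)
Require Import Defs.
From HB Require Import structures.
From mathcomp Require Import all_boot all_order all_algebra.
From mathcomp Require Import all_classical all_reals all_analysis.
From mathcomp Require Import measurable_realfun complex.
From mathcomp Require Import ring lra.
Set Implicit Arguments. Unset Strict Implicit. Unset Printing Implicit Defensive.
Import Order.TTheory GRing.Theory Num.Theory.
Import numFieldNormedType.Exports.
Local Open Scope classical_set_scope.
Local Open Scope ring_scope.

(** Write [x], [y] for the two halves of [X]. Apart from the cutoff and the test
    function, the integrand is the product of [exp (i (x - y) xi)] and
    [b ((x + y) / 2, xi)]. The second factor depends on the midpoint only, so a
    translation of [X] in direction [e_i - e_(d + i)], which preserves [x + y], merely
    multiplies the product by the phase [exp (2 i t xi_i)] ([weyl_phase_shift]).
    Integrating in [X] first, for fixed [xi], one can therefore integrate by parts in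
    these directions with all derivatives falling on the test function
    ([pairing_by_parts]): [p] of them give
      [`|xi| ^ p * |fiber b chi xi| <= const * sup |b| * sup |D^p chi|],
    with [sup |b|] over a fixed compact set of midpoints ([pairing_decay]).

    The growth condition bounds [sup |b|] by [exp (M (m |xi|))], that is, up to the
    factor 2, by one of the terms [(m |xi|) ^ q / M q], and the derivatives of [chi] of
    order [p] by [h ^ p M p]. With [p = q + l], stability of the sequence under
    products (M.2) turns this into a decay of order [l] of the fibre integral, for
    every [l], as soon as [h] is small against [m]; in the Roumieu case the partial
    products of [k] absorb every [h] ([tame_of_series]). The constant is proportional
    to the norm of [chi] in the step of order [h] ([fiber_decay]).

    So the fibre integral is absolutely integrable in [xi]. The kernel [weyl_kernel] is
    defined by integrating it. Fubini's theorem and dominated convergence identify it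
    with the oscillatory integral ([osc_limit]), and the proportionality to the norm is
    its continuity ([weyl_kernel_ultradistribution]). *)

(** * Complex numbers and complex-valued integrals *)

Section complex_modulus.
Variable R : realType.
Local Notation C := (Cplx R).
Local Notation Re := complex.Re.
Local Notation Im := complex.Im.

Lemma modC_sqr (z : C) : modC z ^+ 2 = Re z ^+ 2 + Im z ^+ 2.
Proof.
by case: z => x y /=; rewrite /modC /Normc.normc sqr_sqrtr// addr_ge0// sqr_ge0.
Qed.

Lemma modC_ge0 (z : C) : 0 <= modC z.
Proof. by case: z => x y; rewrite /modC /Normc.normc sqrtr_ge0. Qed.

Lemma modCM (z w : C) : modC (z * w) = modC z * modC w.
Proof. exact: Normc.normcM. Qed.

Lemma le_modCD (z w : C) : modC (z + w) <= modC z + modC w.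
Proof. exact: le_normcD. Qed.

Lemma modCN (z : C) : modC (- z) = modC z.
Proof. exact: normcN. Qed.

Lemma modC0 : modC (0 : C) = 0.
Proof. exact: Normc.normc0. Qed.

Lemma modCR (x : R) : modC (x%:C%C : C) = `|x|.
Proof. by rewrite /modC /Normc.normc/= expr0n/= addr0 sqrtr_sqr. Qed.

Lemma normr_Re_le (z : C) : `|Re z| <= modC z.
Proof.
rewrite -(ler_pXn2r (n := 2)) ?nnegrE ?modC_ge0//.
by rewrite modC_sqr real_normK ?num_real// lerDl sqr_ge0.
Qed.

Lemma normr_Im_le (z : C) : `|Im z| <= modC z.
Proof.
rewrite -(ler_pXn2r (n := 2)) ?nnegrE ?modC_ge0//.
by rewrite modC_sqr real_normK ?num_real// lerDr sqr_ge0.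
Qed.

Lemma modC_le (z : C) : modC z <= `|Re z| + `|Im z|.
Proof.
rewrite -(ler_pXn2r (n := 2)) ?nnegrE ?modC_ge0// ?addr_ge0//.
rewrite modC_sqr sqrrD !real_normK ?num_real//.
by rewrite lerD2r lerDl mulrn_wge0// mulr_ge0.
Qed.

Lemma ReM (z w : C) : Re (z * w) = Re z * Re w - Im z * Im w.
Proof. by case: z w => [a b] [c d]. Qed.

Lemma ImM (z w : C) : Im (z * w) = Re z * Im w + Im z * Re w.
Proof. by case: z w => [a b] [c d]. Qed.

Lemma ReD (z w : C) : Re (z + w) = Re z + Re w.
Proof. by case: z w => [a b] [c d]. Qed.

Lemma ImD (z w : C) : Im (z + w) = Im z + Im w.
Proof. by case: z w => [a b] [c d]. Qed.

Lemma ReN (z : C) : Re (- z) = - Re z. Proof. by case: z. Qed.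

Lemma ImN (z : C) : Im (- z) = - Im z. Proof. by case: z. Qed.

Lemma cplx_ext (z w : C) : Re z = Re w -> Im z = Im w -> z = w.
Proof. by case: z w => [a b] [c d] /= -> ->. Qed.

Lemma cexp_imC (t : R) : cexp (imC R * t%:C%C) = (cos t +i* sin t)%C.
Proof.
rewrite /cexp; have -> : (imC R * t%:C%C = 0 +i* t :> C)%C.
  by apply: cplx_ext; rewrite ?ReM ?ImM/=; ring.
by rewrite /= expR0; apply: cplx_ext; rewrite ?ReM ?ImM/=; ring.
Qed.

Lemma modC_cexp_imC (t : R) : modC (cexp (imC R * t%:C%C)) = 1.
Proof.
apply/eqP; rewrite -(eqrXn2 (n := 2)) ?modC_ge0// modC_sqr cexp_imC expr1n.
by rewrite cos2Dsin2.
Qed.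

Lemma cexp_imCD (s t : R) :
  cexp (imC R * (s + t)%:C%C) = cexp (imC R * s%:C%C) * cexp (imC R * t%:C%C).
Proof.
rewrite !cexp_imC cosD sinD.
by apply: cplx_ext; rewrite ?ReM ?ImM/=; ring.
Qed.

Lemma normr_modC (z : C) : `|z| = (modC z)%:C%C.
Proof. by case: z. Qed.

Lemma cplx_gt0_real (e : C) : 0 < e -> exists2 r : R, 0 < r & e = r%:C%C.
Proof.
case: e => r s; rewrite ltcE/= => /andP[/eqP -> r0]; by exists r.
Qed.

(** With the next two lemmas: the topology that the complex numbers receive as a
    valued field is that of the plane, so that limits can be computed on real and
    imaginary parts, where the convergence theorems for integrals apply. *)
Lemma cvg_cplx T (F : set_system T) {FF : Filter F} (f : T -> C) (l : C) :
  (fun x => Re (f x)) @ F --> Re l -> (fun x => Im (f x)) @ F --> Im l ->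
  f @ F --> l.
Proof.
move=> /cvgrPdist_lt fRe /cvgrPdist_lt fIm.
apply/cvgrPdist_lt => _ /cplx_gt0_real[e e0 ->].
have e20 : 0 < e / 2 by rewrite divr_gt0.
near=> x; rewrite normr_modC ltcR (le_lt_trans (modC_le _))//.
rewrite ReD ImD ReN ImN (splitr e) ltrD//.
  by near: x; exact: fRe.
by near: x; exact: fIm.
Unshelve. all: by end_near. Qed.

Lemma cvg_Re T (F : set_system T) {FF : Filter F} (f : T -> C) (l : C) :
  f @ F --> l -> (fun x => Re (f x)) @ F --> Re l.
Proof.
move=> /cvgrPdist_lt fl; apply/cvgrPdist_lt => e e0.
have : 0 < e%:C%C :> C by rewrite ltcR.
move/fl; apply: filterS => x; rewrite normr_modC ltcR; apply: le_lt_trans.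
by rewrite -ReN -ReD normr_Re_le.
Qed.

Lemma cvg_Im T (F : set_system T) {FF : Filter F} (f : T -> C) (l : C) :
  f @ F --> l -> (fun x => Im (f x)) @ F --> Im l.
Proof.
move=> /cvgrPdist_lt fl; apply/cvgrPdist_lt => e e0.
have : 0 < e%:C%C :> C by rewrite ltcR.
move/fl; apply: filterS => x; rewrite normr_modC ltcR; apply: le_lt_trans.
by rewrite -ImN -ImD normr_Im_le.
Qed.

End complex_modulus.

Section complex_integral.
Context d (T : measurableType d) (R : realType).
Variable mu : {measure set T -> \bar R}.
Local Notation C := (Cplx R).
Local Notation Re := complex.Re.
Local Notation Im := complex.Im.
Implicit Types f g : T -> C.

Definition cmeasurable d' (U : measurableType d') (f : U -> C) : Prop :=
  measurable_fun setT (fun x => Re (f x) : measurableTypeR R) /\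
  measurable_fun setT (fun x => Im (f x) : measurableTypeR R).

Lemma cmeasurable_cst (z : C) : cmeasurable (fun _ : T => z).
Proof. by split; exact: measurable_cst. Qed.

Lemma cmeasurableD f g : cmeasurable f -> cmeasurable g ->
  cmeasurable (fun x => f x + g x).
Proof.
move=> [fr fi] [gr gi]; split.
  by under eq_fun do rewrite ReD; exact: measurable_funD.
by under eq_fun do rewrite ImD; exact: measurable_funD.
Qed.

Lemma cmeasurableM f g : cmeasurable f -> cmeasurable g ->
  cmeasurable (fun x => f x * g x).
Proof.
move=> [fr fi] [gr gi]; split.
  under eq_fun do rewrite ReM.
  by apply: measurable_funB; exact: measurable_funM.
under eq_fun do rewrite ImM.
by apply: measurable_funD; exact: measurable_funM.
Qed.

Lemma cmeasurable_comp d' (U : measurableType d') (f : U -> C) (h : T -> U) :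
  cmeasurable f -> measurable_fun setT h -> cmeasurable (f \o h).
Proof.
by move=> [fr fi] mh; split;
  [exact: (measurableT_comp fr)|exact: (measurableT_comp fi)].
Qed.

Lemma cmeasurable_cexp_imC (t : T -> R) :
  measurable_fun setT (t : T -> measurableTypeR R) ->
  cmeasurable (fun x => cexp (imC R * (t x)%:C%C)).
Proof.
move=> mt; split; under eq_fun do rewrite cexp_imC /=.
  apply: (measurableT_comp (f := cos)) mt.
  by apply: continuous_measurable_fun; exact: continuous_cos.
apply: (measurableT_comp (f := sin)) mt.
by apply: continuous_measurable_fun; exact: continuous_sin.
Qed.

Lemma cintegrable_dominated f (g : T -> R) : cmeasurable f ->
  mu.-integrable setT (EFin \o g) -> (forall x, modC (f x) <= g x) ->
  cintegrable mu f.
Proof.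
move=> [mr mi] ig fg; split; apply: le_integrable ig => //.
- exact/measurable_EFinP.
- move=> x _ /=; rewrite lee_fin (le_trans (normr_Re_le _))//.
  by rewrite (le_trans (fg x))// ler_norm.
- exact/measurable_EFinP.
- move=> x _ /=; rewrite lee_fin (le_trans (normr_Im_le _))//.
  by rewrite (le_trans (fg x))// ler_norm.
Qed.

Lemma cintegralD f g : cintegrable mu f -> cintegrable mu g ->
  cintegral mu (fun x => f x + g x) = cintegral mu f + cintegral mu g.
Proof.
move=> [fr fi] [gr gi]; apply: cplx_ext; rewrite ?ReD ?ImD /=.
  by under eq_Rintegral do rewrite ReD; rewrite RintegralD.
by under eq_Rintegral do rewrite ImD; rewrite RintegralD.
Qed.

Let integrable_scale (k : R) (f : T -> R) : mu.-integrable setT (EFin \o f) ->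
  mu.-integrable setT (EFin \o (fun x => k * f x)).
Proof. by move=> fi; exact: (integrableZl measurableT k fi). Qed.

Lemma cintegralZ (z : C) f : cintegrable mu f ->
  cintegral mu (fun x => z * f x) = z * cintegral mu f.
Proof.
move=> [fr fi]; apply: cplx_ext; rewrite ?ReM ?ImM /=.
  under eq_Rintegral do rewrite ReM.
  by rewrite RintegralB ?RintegralZl//; exact: integrable_scale.
under eq_Rintegral do rewrite ImM.
by rewrite RintegralD ?RintegralZl//; exact: integrable_scale.
Qed.

Lemma cintegrableZ (z : C) f : cintegrable mu f ->
  cintegrable mu (fun x => z * f x).
Proof.
move=> [fr fi]; split.
  have := integrableB measurableT (integrable_scale (Re z) fr)
    (integrable_scale (Im z) fi).
  by apply: eq_integrable => // x _ /=; rewrite ReM.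
have := integrableD measurableT (integrable_scale (Re z) fi)
  (integrable_scale (Im z) fr).
by apply: eq_integrable => // x _ /=; rewrite ImM.
Qed.

(** The factor 2 comes from bounding the real and the imaginary part separately;
    only the order of magnitude matters below. *)
Lemma modC_cintegral_le f (g : T -> R) : cmeasurable f ->
  mu.-integrable setT (EFin \o g) -> (forall x, modC (f x) <= g x) ->
  modC (cintegral mu f) <= 2 * Rintegral mu setT g.
Proof.
move=> mf ig fg; have [fr fi] := cintegrable_dominated mf ig fg.
rewrite (le_trans (modC_le _))//= mulr_natl mulr2n lerD//.
  rewrite (le_trans (le_normr_Rintegral _ _))//; apply: le_Rintegral => //.
    exact: integrable_norm.
  by move=> x _; rewrite (le_trans (normr_Re_le _)).
rewrite (le_trans (le_normr_Rintegral _ _))//; apply: le_Rintegral => //.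
  exact: integrable_norm.
by move=> x _; rewrite (le_trans (normr_Im_le _)).
Qed.

Let Rintegral_cvg (f_ : nat -> T -> R) (f g : T -> R) :
  (forall n, measurable_fun setT (f_ n : T -> measurableTypeR R)) ->
  mu.-integrable setT (EFin \o g) -> (forall n x, `|f_ n x| <= g x) ->
  (forall x, f_ ^~ x @ \oo --> f x) ->
  Rintegral mu setT (f_ n) @[n --> \oo] --> Rintegral mu setT f.
Proof.
move=> mf ig fg cf.
have h1 : forall n, measurable_fun setT (EFin \o f_ n).
  by move=> n; exact/measurable_EFinP/mf.
have h2 x : setT x -> (fun n => (EFin \o f_ n) x) @ \oo --> (EFin \o f) x.
  by move=> _; apply: cvg_EFin; [exact: nearW|exact: cf].
have h3 : forall n x, setT x -> (`|(EFin \o f_ n) x| <= (EFin \o g) x)%E.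
  by move=> n x _; rewrite /= lee_fin.
have mef : measurable_fun setT (EFin \o f).
  by apply: (emeasurable_fun_cvg (fun n => EFin \o f_ n)) => // x _; exact: h2.
have [ifn _ cvgI] := dominated_convergence measurableT h1 mef
  (aeW mu h2) ig (aeW mu (fun x n => @h3 n x)).
by apply: fine_cvg; rewrite fineK//; exact: integrable_fin_num.
Qed.

Lemma cintegral_cvg (f_ : nat -> T -> C) f (g : T -> R) :
  (forall n, cmeasurable (f_ n)) ->
  mu.-integrable setT (EFin \o g) -> (forall n x, modC (f_ n x) <= g x) ->
  (forall x, f_ ^~ x @ \oo --> f x) ->
  cintegral mu (f_ n) @[n --> \oo] --> cintegral mu f.
Proof.
move=> mf ig fg cf; apply: cvg_cplx => /=.
  apply: (Rintegral_cvg (g := g)) => // [n|n x|x].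
  - by have [] := mf n.
  - by rewrite (le_trans (normr_Re_le _)).
  - by apply: (@cvg_Re _ _ _ _ (f_ ^~ x)); exact: cf.
apply: (Rintegral_cvg (g := g)) => // [n|n x|x].
- by have [] := mf n.
- by rewrite (le_trans (normr_Im_le _)).
- by apply: (@cvg_Im _ _ _ _ (f_ ^~ x)); exact: cf.
Qed.

End complex_integral.

(** * Borel structure and Lebesgue measure on row vectors *)

Section rV_norm.
Variable R : realType.

Lemma rV_norm_ltP n (x : 'rV[R]_n) (e : R) : 0 < e ->
  `|x| < e <-> forall j, `|x 0 j| < e.
Proof.
move=> e0; rewrite [`|x|]/Num.norm/= mx_normrE; split.
  by move=> /bigmax_ltP[_ h] j; exact: (h (0, j)).
by move=> h; apply/bigmax_ltP; split=> // -[i j] _; rewrite (ord1 i) /=.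
Qed.

Lemma rV_norm_leP n (x : 'rV[R]_n) (e : R) : 0 <= e ->
  `|x| <= e <-> forall j, `|x 0 j| <= e.
Proof.
move=> e0; rewrite [`|x|]/Num.norm/= mx_normrE; split.
  by move=> /bigmax_leP[_ h] j; exact: (h (0, j)).
by move=> h; apply/bigmax_leP; split=> // -[i j] _; rewrite (ord1 i) /=.
Qed.

Lemma normr_coord_le n (x : 'rV[R]_n) j : `|x 0 j| <= `|x|.
Proof. by move/rV_norm_leP : (lexx `|x|); apply. Qed.

Lemma rV_norm_attained n (x : 'rV[R]_n) : (0 < n)%N ->
  exists j, `|x 0 j| = `|x|.
Proof.
move=> n0; have [->|x0] := eqVneq x 0.
  by exists (Ordinal n0); rewrite mxE !normr0.
have : mx_norm x != 0 by apply: contra_neq x0; exact: mx_norm_eq0.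
by move=> /mx_norm_neq0[[i j]]; rewrite (ord1 i) => xj; exists j; rewrite -xj.
Qed.

Lemma enorm_le n (x : 'rV[R]_n) : enorm x <= n%:R * `|x|.
Proof.
rewrite /enorm -[leRHS]ger0_norm ?mulr_ge0// -sqrtr_sqr ler_wsqrtr//.
apply: (@le_trans _ _ (\sum_(j < n) `|x| ^+ 2)).
  apply: ler_sum => j _; rewrite -[x 0 j ^+ 2]real_normK ?num_real//.
  by rewrite lerXn2r ?nnegrE// normr_coord_le.
rewrite sumr_const card_ord exprMn -[leLHS]mulr_natl ler_wpM2r ?sqr_ge0//.
case: n x => [|n] x; first by rewrite expr0n.
by rewrite expr2 ler_peMl// ler1n.
Qed.

End rV_norm.

Section rV_borel.
Variable R : realType.

(** Boxes with rational centre and radius [1 / (k + 1)] form a countable base of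
    the topology, so that the sigma-algebra generated by the coordinates contains
    every open set. *)
Lemma open_measurable_rV n (U : set 'rV[R]_n) : open U -> measurable U.
Proof.
move=> oU.
pose box (q : 'rV[rat]_n * nat) : set 'rV[R]_n :=
  \bigcap_(j in [set: 'I_n])
    (fun x : 'rV[R]_n => x 0 j) @^-1` ball (ratr (q.1 0 j) : R) q.2.+1%:R^-1.
have mbox q : measurable (box q).
  apply: fin_bigcap_measurable => // j _; rewrite -[X in measurable X]setTI.
  by apply: measurable_coord_rV => //; exact: measurable_ball.
have -> : U = \bigcup_q (if `[< box q `<=` U >] then box q else set0).
  apply/seteqP; split => [x Ux|x [q _]]; last by case: asboolP => [bU /bU|_ []].
  have /nbhs_ballP[e /= e0 xeU] := open_nbhs_nbhs (conj oU Ux).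
  have e20 : 0 < e / 2 by rewrite divr_gt0.
  pose k := Num.truncn (e / 2)^-1.
  have ke : k.+1%:R^-1 < e / 2.
    by rewrite invf_plt ?posrE// truncnS_gt.
  have /choice[q qx] : forall j, exists q : rat,
      ball (ratr q : R) k.+1%:R^-1 (x 0 j).
    move=> j; have : x 0 j - k.+1%:R^-1 < x 0 j + k.+1%:R^-1.
      by rewrite ltrD2l gtrN ?invr_gt0.
    move=> /rat_in_itvoo[r]; rewrite in_itv/= => rP; exists r.
    by rewrite /ball/= ltr_distl.
  exists (\row_j q j, k) => //.
  have xbox : box (\row_j q j, k) x by move=> j _ /=; rewrite mxE; exact: qx.
  case: asboolP => // abs; exfalso; apply: abs => y yq; apply: xeU.
  rewrite mx_norm_ball /ball_/= rV_norm_ltP// => j; rewrite !mxE.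
  have := yq j I; have := xbox j I; rewrite /= mxE /ball/= => h1 h2.
  rewrite (splitr e) -(subrK (ratr (q j)) (x 0 j)) -addrA.
  by rewrite (le_lt_trans (ler_normD _ _))// ltrD// (lt_trans _ ke)// distrC.
apply: countable_bigcupT_measurable => [|q]; first exact: countableP.
by case: ifPn => // _; exact: mbox.
Qed.

Lemma continuous_measurable_rV n (f : 'rV[R]_n -> R) : continuous f ->
  measurable_fun setT (f : 'rV[R]_n -> measurableTypeR R).
Proof.
move=> /continuousP cf; apply: (measurability _ (RGenOpens.measurableE R)).
move=> _ [_ [a [b ->] <-]]; rewrite setTI; apply: open_measurable_rV.
exact/cf/interval_open.
Qed.

Lemma continuous_cmeasurable n (f : cfun R n) : continuous f -> cmeasurable f.
Proof.
move=> cf; split; apply: continuous_measurable_rV => x.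
  exact: (@cvg_Re _ _ _ _ f _ (cf x)).
exact: (@cvg_Im _ _ _ _ f _ (cf x)).
Qed.

Definition cube n (r : R) : set 'rV[R]_n := [set x | `|x| <= r].

Lemma closed_cube n r : closed (@cube n r).
Proof.
exact: (closed_comp (f := @Num.norm R 'rV[R]_n) (D := [set t | t <= r])
  (fun x _ => @norm_continuous _ _ x) (@closed_le _ r)).
Qed.

Lemma measurable_cube n r : measurable (@cube n r).
Proof.
rewrite -[X in measurable X]setCK; apply: measurableC.
by apply: open_measurable_rV; rewrite openC; exact: closed_cube.
Qed.

Lemma lebesgue_cube_lty n (r : R) : 0 <= r -> (lebesgue_rV R n (cube r) < +oo)%E.
Proof.
move=> r0; elim: n => [|n IH].
  rewrite /= diracE; exact: ltry.
rewrite /= /lebesgue_rV_step /pushforward.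
have -> : @rV_cons R n @^-1` cube r = `[- r, r]%classic `*` cube r.
  apply/seteqP; split => -[t x] /=; rewrite /cube /= !rV_norm_leP//.
    move=> h; split.
      by have := h 0; rewrite mxE unlift_none /= in_itv/= ler_norml.
    by move=> j; have := h (lift 0 j); rewrite mxE liftK.
  move=> [tr xr] j; rewrite mxE; case: unliftP => [k _|_] /=; first exact: xr.
  by move: tr; rewrite in_itv/= ler_norml.
rewrite product_measure1E//; last exact: measurable_cube.
rewrite [X in (X * _)%E](_ : _ = if (- r < r)%R then (r - - r)%:E else 0%E);
  last exact: (lebesgue_measure_itv `[- r, r]).
case: ifP => _; last by rewrite mul0e ltry.
by rewrite lte_mul_pinfty// lee_fin opprK addr_ge0.
Qed.

End rV_borel.

Section translation.
Variable R : realType.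

Let mshift (a : R) : measurable_fun setT
  ((fun t => t + a) : measurableTypeR R -> measurableTypeR R).
Proof. by apply: measurable_funD => //; exact: measurable_cst. Qed.

Lemma lebesgue_measure_shift (a : R) (A : set (measurableTypeR R)) : measurable A ->
  pushforward (@lebesgue_measure R)
    ((fun t => t + a) : measurableTypeR R -> measurableTypeR R) A
  = lebesgue_measure A.
Proof.
move=> mA; apply/esym.
pose mu' : {measure set (measurableTypeR R) -> \bar R} :=
  measure_function_pushforward__canonical__measure_function_Measure
    (@lebesgue_measure R) (mshift a).
apply: (@lebesgue_measure_unique R mu') => // _ [[u v]] _ <-.
rewrite /mu'/= /pushforward.
have -> : (fun t => t + a) @^-1` `]u, v]%classic = `]u - a, v - a]%classic.
  by apply/seteqP; split=> t /=; rewrite !in_itv/= ltrBlDr lerBrDr.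
rewrite [LHS](lebesgue_measure_itv `]u, v]).
rewrite [RHS](lebesgue_measure_itv `]u - a, v - a]).
by rewrite /= !lte_fin ltrD2r -!EFinB; congr (if _ then _ else _); congr EFin; ring.
Qed.

Lemma measurable_rV_shift n (w : 'rV[R]_n) : measurable_fun setT (fun x : 'rV[R]_n => x + w).
Proof.
apply: measurable_fun_rV => i; under eq_fun do rewrite mxE.
by apply: measurable_funD; [exact: measurable_coord_rV|exact: measurable_cst].
Qed.

(** By induction on the dimension: translations act on each factor of the product
    measure, which is determined by its values on rectangles. *)
Lemma lebesgue_rV_shift n (w : 'rV[R]_n) (A : set 'rV[R]_n) : measurable A ->
  lebesgue_rV R n ((fun x => x + w) @^-1` A) = lebesgue_rV R n A.
Proof.
elim: n w A => [|n IH] w A mA.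
  by congr (_ _); apply/seteqP; split=> x /=; rewrite (thinmx0 w) addr0.
rewrite /= /lebesgue_rV_step /pushforward.
pose w' := rV_uncons w.
pose s (p : measurableTypeR R * 'rV[R]_n) : measurableTypeR R * 'rV[R]_n :=
  (p.1 + w'.1, p.2 + w'.2).
have ms : measurable_fun setT s.
  apply: measurable_fun_pair.
    by apply: measurable_funD; [exact: measurable_fst|exact: measurable_cst].
  by apply: (measurableT_comp (measurable_rV_shift w'.2)); exact: measurable_snd.
have -> : @rV_cons R n @^-1` ((fun x => x + w) @^-1` A) = s @^-1` (@rV_cons R n @^-1` A).
  apply/seteqP; split => -[t x] /=; set l := (X in A X); set r := (X in _ -> A X);
    suff -> : l = r by []; apply/rowP => j; rewrite /l /r !mxE;
    by case: unliftP => [k ->|->]; rewrite /= ?mxE.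
have mA' : measurable (@rV_cons R n @^-1` A).
  by rewrite -[X in measurable X]setTI; exact: measurable_rV_cons.
pose m' := measure_function_pushforward__canonical__measure_function_Measure
  (@lebesgue_measure R \x lebesgue_rV R n)%E ms.
apply/esym/(@product_measure_unique _ _ _ _ _ _ _ m') => // B D mB mD.
rewrite /m' /= /pushforward.
have -> : s @^-1` (B `*` D) =
    ((fun t => t + w'.1) @^-1` B) `*` ((fun x => x + w'.2) @^-1` D).
  by [].
rewrite product_measure1E.
- by rewrite -[in RHS](lebesgue_measure_shift w'.1 mB) -[in RHS](IH w'.2 D mD).
- by rewrite -[X in measurable X]setTI; exact: mshift.
- by rewrite -[X in measurable X]setTI; exact: measurable_rV_shift.
Qed.

Lemma Rintegral_rV_shift n (w : 'rV[R]_n) (f : 'rV[R]_n -> R) :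
  measurable_fun setT (f : 'rV[R]_n -> measurableTypeR R) ->
  (lebesgue_rV R n).-integrable setT (EFin \o f) ->
  Rintegral (lebesgue_rV R n) setT (fun x => f (x + w)) =
  Rintegral (lebesgue_rV R n) setT f.
Proof.
move=> mf fi; rewrite /Rintegral; congr fine.
have mef : measurable_fun setT (EFin \o f) by exact/measurable_EFinP.
have E (A : set 'rV[R]_n) : measurable A -> A `<=` setT ->
    measure_function_pushforward__canonical__measure_function_Measure
      (lebesgue_rV R n) (measurable_rV_shift w) A = lebesgue_rV R n A.
  by move=> mA _; exact: lebesgue_rV_shift.
have ms := measurable_rV_shift w.
have fis : (lebesgue_rV R n).-integrable ((fun x => x + w) @^-1` setT)
    ((EFin \o f) \o (fun x => x + w)).
  rewrite preimage_setT; apply/integrableP; split; first exact: measurableT_comp.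
  have /integrableP[_] := fi; apply: le_lt_trans.
  rewrite -[leRHS](eq_measure_integral _ E) le_eqVlt; apply/orP; left; apply/eqP/esym.
  apply: (ge0_integral_pushforward ms (lebesgue_rV R n) (D := setT)
    (f := fun x => `|(f x)%:E|%E)) => //.
  exact: measurableT_comp.
rewrite -[RHS](eq_measure_integral _ E); apply/esym.
exact: (integral_pushforward ms (mu := lebesgue_rV R n) (D := setT) mef fis).
Qed.

End translation.

(** * Iterated integrals and an integrable decay rate *)

Section fubini.
Context d1 d2 (T1 : measurableType d1) (T2 : measurableType d2) (R : realType).
Variables (m1 : {sigma_finite_measure set T1 -> \bar R}).
Variables (m2 : {sigma_finite_measure set T2 -> \bar R}).
Variable f : T1 * T2 -> Cplx R.
Hypothesis mf : cmeasurable f.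

Let measurable_Rintegral_section (g : T1 * T2 -> R) :
  measurable_fun setT (g : T1 * T2 -> measurableTypeR R) ->
  measurable_fun setT
    ((fun y => Rintegral m1 setT (fun x => g (x, y))) : T2 -> measurableTypeR R).
Proof.
move=> /measurable_EFinP mg; rewrite /Rintegral.
under eq_fun do rewrite integralE.
apply: (measurableT_comp (fine_measurable _)) => //; apply: emeasurable_funB.
  have := @measurable_fun_fubini_tonelli_G _ _ _ _ _ m1 _ (measurable_funepos mg)
    (fun x => funepos_ge0 _ x).
  apply: eq_measurable_fun => y _; apply: eq_integral => x _.
  by rewrite funeposE [in RHS]funeposE.
have := @measurable_fun_fubini_tonelli_G _ _ _ _ _ m1 _ (measurable_funeneg mg)
  (fun x => funeneg_ge0 _ x).
apply: eq_measurable_fun => y _; apply: eq_integral => x _.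
by rewrite funenegE [in RHS]funenegE.
Qed.

Lemma cmeasurable_cintegral_section :
  cmeasurable (fun y => cintegral m1 (fun x => f (x, y))).
Proof.
by case: mf => fr fi; split;
  [exact: (measurable_Rintegral_section fr)|exact: (measurable_Rintegral_section fi)].
Qed.

Let Rintegral_fubini (g : T1 * T2 -> R) :
  (m1 \x m2)%E.-integrable setT (EFin \o g) ->
  (forall y, m1.-integrable setT (fun x => (g (x, y))%:E)) ->
  Rintegral (m1 \x m2)%E setT g =
  Rintegral m2 setT (fun y => Rintegral m1 setT (fun x => g (x, y))).
Proof.
move=> ig igy; rewrite /Rintegral -(integral21_prod_meas1 ig); congr fine.
by apply: eq_integral => y _; rewrite fineK//; exact: integrable_fin_num.
Qed.

Lemma cintegral_fubini : cintegrable (m1 \x m2)%E f ->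
  (forall y, cintegrable m1 (fun x => f (x, y))) ->
  cintegral (m1 \x m2)%E f = cintegral m2 (fun y => cintegral m1 (fun x => f (x, y))).
Proof.
move=> [ir ii] iy; apply: cplx_ext => /=; apply: Rintegral_fubini => // y.
  by have [] := iy y.
by have [] := iy y.
Qed.

End fubini.

Section decay_weight.
Variable R : realType.

Let oneDsqr_gt0 (t : R) : 0 < oneDsqr t.
Proof. by rewrite (lt_le_trans ltr01) ?oneDsqr_ge1. Qed.

(** A product of one-variable functions, so that its integrability reduces to that
    of [1 / (1 + t ^ 2)] by induction on the dimension. *)
Definition decay n (x : 'rV[R]_n) : R := \prod_j (oneDsqr (x 0 j))^-1.

Lemma decay_gt0 n (x : 'rV[R]_n) : 0 < decay x.
Proof. by apply: prodr_gt0 => j _; rewrite invr_gt0 oneDsqr_gt0. Qed.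

Lemma measurable_decay n : measurable_fun setT (@decay n : _ -> measurableTypeR R).
Proof.
apply: measurable_prod => j _.
apply: (measurableT_comp (f := fun t => (oneDsqr t)^-1)) (measurable_coord_rV j).
by apply: continuous_measurable_fun; exact: continuous_oneDsqrV.
Qed.

Lemma integral_oneDsqrV_lty :
  (\int[@lebesgue_measure R]_t ((oneDsqr t)^-1)%:E < +oo)%E.
Proof.
rewrite (ge0_symfun_integralT (f := fun t => (oneDsqr t)^-1)).
- rewrite (_ : [set x | 0 <= x] = `[0%R, +oo[%classic); last first.
    by apply/seteqP; split => x /=; rewrite in_itv/= andbT.
  by rewrite integral0y_oneDsqr ltry.
- by move=> x; rewrite /= invr_ge0 ltW// oneDsqr_gt0.
- exact: continuous_oneDsqrV.
- by move=> x /=; rewrite /oneDsqr sqrrN.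
Qed.

Lemma integrable_decay n : (lebesgue_rV R n).-integrable setT (EFin \o @decay n).
Proof.
apply/integrableP; split; first by apply/measurable_EFinP; exact: measurable_decay.
under eq_integral do rewrite /= ger0_norm ?ltW ?decay_gt0//.
elim: n => [|n IH].
  rewrite /= integral_dirac//.
    by rewrite diracT mul1e ltry.
  by apply/measurable_EFinP; exact: measurable_decay.
have mD : measurable_fun setT (fun x : 'rV[R]_n.+1 => (decay x)%:E).
  by apply/measurable_EFinP; exact: measurable_decay.
rewrite /= (ge0_integral_pushforward (@measurable_rV_cons R n)
  (@lebesgue_measure R \x lebesgue_rV R n)%E (D := setT)
  (f := fun x => (decay x)%:E))//; last first.
  by move=> y _; rewrite lee_fin ltW ?decay_gt0.
rewrite preimage_setT fubini_tonelli1//=; first last.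
  by move=> x; rewrite lee_fin ltW ?decay_gt0.
  apply: measurableT_comp => //; exact: measurable_rV_cons.
pose c := (\int[lebesgue_rV R n]_x (decay x)%:E)%E.
rewrite (eq_integral (fun t : measurableTypeR R => ((oneDsqr t)^-1)%:E * c)%E); last first.
  move=> t _; rewrite /fubini_F /c -ge0_integralZl//.
  - apply: eq_integral => x _; rewrite -EFinM; congr EFin.
    rewrite /decay big_ord_recl mxE unlift_none /=; congr (_ * _).
    by apply: eq_bigr => j _; rewrite mxE liftK.
  - by apply/measurable_EFinP; exact: measurable_decay.
  - by move=> x _; rewrite lee_fin ltW ?decay_gt0.
have c0 : (0 <= c)%E by apply: integral_ge0 => x _; rewrite lee_fin ltW ?decay_gt0.
rewrite ge0_integralZr//.
- rewrite lte_mul_pinfty//.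
  + by apply: integral_ge0 => t _; rewrite lee_fin invr_ge0 ltW// oneDsqr_gt0.
  + rewrite ge0_fin_numE; first exact: integral_oneDsqrV_lty.
    by apply: integral_ge0 => t _; rewrite lee_fin invr_ge0 ltW// oneDsqr_gt0.
- apply/measurable_EFinP; apply: continuous_measurable_fun.
  exact: continuous_oneDsqrV.
Qed.

End decay_weight.

(** * Partial derivatives of smooth functions *)

Section coordinate_derivatives.
Variable R : realType.
Implicit Types (n : nat).

Lemma is_derive_line n (g : 'rV[R]_n -> R) (x e : 'rV[R]_n) (s : R) :
  derivable g (s *: e + x) e ->
  is_derive s 1 (fun t : R => g (t *: e + x)) ('D_e g (s *: e + x)).
Proof.
move=> dg; suff E : (fun h : R => h^-1 *:
       (((fun t : R => g (t *: e + x)) \o shift s) (h *: 1) - g (s *: e + x)))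
   = (fun h => h^-1 *: ((g \o shift (s *: e + x)) (h *: e) - g (s *: e + x))).
  by apply: DeriveDef; [rewrite /derivable E|rewrite /derive E].
apply/funext => h /=; congr (_ *: (g _ - _)).
by rewrite [h *: 1]mulr1 scalerDl addrA.
Qed.

Lemma coord_MVT n (g : 'rV[R]_n -> R) (x e : 'rV[R]_n) (t : R) : 0 <= t ->
  (forall y, derivable g y e) ->
  exists2 s, 0 <= s <= t & g (t *: e + x) - g x = t * 'D_e g (s *: e + x).
Proof.
move=> t0 dg.
have [|s st E] := @MVT_segment R (fun t : R => g (t *: e + x))
    (fun s => 'D_e g (s *: e + x)) 0 t t0 (fun s _ => is_derive_line (dg _)).
  by apply: derivable_within_continuous => s _; apply: ex_derive; exact: is_derive_line.
exists s; first by move: st; rewrite in_itv.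
by rewrite scale0r add0r subr0 in E; rewrite E mulrC.
Qed.

Lemma derive_translate n (g : 'rV[R]_n -> R) (x w e : 'rV[R]_n) :
  derivable g (w + x) e ->
  is_derive x e (fun y => g (w + y)) ('D_e g (w + x)).
Proof.
move=> dg; suff E : (fun h : R => h^-1 *:
       (((fun y => g (w + y)) \o shift x) (h *: e) - g (w + x)))
   = (fun h => h^-1 *: ((g \o shift (w + x)) (h *: e) - g (w + x))).
  by apply: DeriveDef; [rewrite /derivable E|rewrite /derive E].
by apply/funext => h /=; congr (_ *: (g _ - _)); rewrite addrCA.
Qed.

Lemma continuous_rVP n (g : 'rV[R]_n -> R) (x : 'rV[R]_n) (e : R) :
  continuous g -> 0 < e ->
  exists2 r : R, 0 < r & forall y, `|y| <= r -> `|g (y + x) - g x| < e.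
Proof.
move=> cg e0; have /cvgrPdist_lt/(_ e e0)/nbhs_ballP[r /= r0 h] := cg x.
have r20 : 0 < r / 2 by rewrite divr_gt0.
exists (r / 2) => // y yr; rewrite distrC; apply: h.
rewrite mx_norm_ball /ball_/= opprD addrA addrC addrA addNr add0r normrN.
by rewrite (le_lt_trans yr)// ltr_pdivrMr// ltr_pMr// ltr1n.
Qed.

Let half_triangle (u v w e : R) :
  `|w - u| < e / 2 -> `|w - v| < e / 2 -> `|u - v| < e.
Proof.
move=> wu wv; rewrite (splitr e) -(subrK w u) -addrA.
by rewrite (le_lt_trans (ler_normD _ _))// ltrD// distrC.
Qed.

(** Schwarz's theorem: by the mean value theorem applied twice, the second
    difference of [f] over a small parallelogram is a value of either mixed
    derivative at a nearby point. *)
Lemma derive_comm n (f : 'rV[R]_n -> R) (e1 e2 x : 'rV[R]_n) :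
  (forall y, derivable f y e1) -> (forall y, derivable f y e2) ->
  (forall y, derivable ('D_e1 f) y e2) -> (forall y, derivable ('D_e2 f) y e1) ->
  continuous ('D_e2 ('D_e1 f)) -> continuous ('D_e1 ('D_e2 f)) ->
  'D_e2 ('D_e1 f) x = 'D_e1 ('D_e2 f) x.
Proof.
have mixed (a b : 'rV[R]_n) (t : R) : 0 <= t ->
    (forall y, derivable f y a) -> (forall y, derivable ('D_a f) y b) ->
    exists s r, [/\ 0 <= s <= t, 0 <= r <= t &
      f (t *: b + (t *: a + x)) - f (t *: a + x) - (f (t *: b + x) - f x) =
      t * (t * 'D_b ('D_a f) (r *: b + (s *: a + x)))].
  move=> t0 da dab; pose phi y := f (t *: b + y) - f y.
  have dphi y : is_derive y a phi ('D_a f (t *: b + y) - 'D_a f y).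
    by apply: is_deriveB; [exact: derive_translate|exact: derivableP].
  have [s st E] := @coord_MVT n phi x a t t0 (fun y => @ex_derive _ _ _ _ _ _ _ (dphi y)).
  have [r rt F] := @coord_MVT n ('D_a f) (s *: a + x) b t t0 dab.
  exists s, r; split => //.
  by move: E; rewrite /phi (@derive_val _ _ _ _ _ _ _ (dphi _)) F.
move=> d1 d2 d12 d21 c12 c21; apply/eqP/negPn/negP => neq.
pose eps := `|'D_e2 ('D_e1 f) x - 'D_e1 ('D_e2 f) x|.
have eps0 : 0 < eps / 2 by rewrite divr_gt0// normr_gt0 subr_eq0.
have [r1 r10 h1] := continuous_rVP x c12 eps0.
have [r2 r20 h2] := continuous_rVP x c21 eps0.
pose m := 1 + `|e1| + `|e2|.
have m0 : 0 < m by rewrite /m -addrA ltr_wpDr// addr_ge0.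
pose t := Num.min r1 r2 / m.
have t0 : 0 < t by rewrite divr_gt0// lt_min r10.
have small (u v : 'rV[R]_n) s r : `|u| + `|v| <= m -> 0 <= s <= t -> 0 <= r <= t ->
    `|r *: u + s *: v| <= Num.min r1 r2.
  move=> uv /andP[s0 st] /andP[r0 rt].
  rewrite (le_trans (ler_normD _ _))// !normrZ !ger0_norm//.
  rewrite (@le_trans _ _ (t * `|u| + t * `|v|))//.
    by rewrite lerD// ler_wpM2r.
  rewrite -mulrDr (@le_trans _ _ (t * m))//; first by rewrite ler_pM2l.
  by rewrite /t divfK// gt_eqF.
have [s [r [st rt E]]] := mixed e1 e2 t (ltW t0) d1 d12.
have [s' [r' [st' rt' E']]] := mixed e2 e1 t (ltW t0) d2 d21.
have : 'D_e2 ('D_e1 f) (r *: e2 + (s *: e1 + x)) =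
    'D_e1 ('D_e2 f) (r' *: e1 + (s' *: e2 + x)).
  apply: (@mulfI _ t); first by rewrite gt_eqF.
  apply: (@mulfI _ t); first by rewrite gt_eqF.
  apply: (etrans (esym E)); apply: (etrans _ E').
  have -> : t *: e1 + (t *: e2 + x) = t *: e2 + (t *: e1 + x) by rewrite addrCA.
  have alg (p q u v : R) : p - q - (u - v) = p - u - (q - v) by ring.
  exact: alg.
rewrite !addrA => EE.
have e12 : `|e1| + `|e2| <= m by rewrite /m -addrA lerDr.
have e21 : `|e2| + `|e1| <= m by rewrite addrC.
have b1 : `|r *: e2 + s *: e1| <= r1.
  by apply: (le_trans (small e2 e1 s r e21 st rt)); rewrite ge_min lexx.
have b2 : `|r' *: e1 + s' *: e2| <= r2.
  by apply: (le_trans (small e1 e2 s' r' e12 st' rt')); rewrite ge_min lexx orbT.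
have := h1 _ b1; have := h2 _ b2; rewrite -EE => k2 k1.
by have := half_triangle k1 k2; rewrite ltxx.
Qed.

(** The same theorem with all derivatives given as explicit functions, the form in
    which it applies to real and imaginary parts. *)
Lemma is_derive_comm n (u u1 u2 u12 u21 : 'rV[R]_n -> R) (e1 e2 x : 'rV[R]_n) :
  (forall y, is_derive y e1 u (u1 y)) -> (forall y, is_derive y e2 u (u2 y)) ->
  (forall y, is_derive y e2 u1 (u12 y)) -> (forall y, is_derive y e1 u2 (u21 y)) ->
  continuous u12 -> continuous u21 -> u12 x = u21 x.
Proof.
have D_fun (v dv : 'rV[R]_n -> R) e : (forall y, is_derive y e v (dv y)) ->
    (forall y, derivable v y e) /\ 'D_e v = dv.
  move=> h; split; first by move=> y; have [] := h y.
  by apply/funext => y; have [] := h y.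
move=> /D_fun[d1 E1] /D_fun[d2 E2] /D_fun[d12 E12] /D_fun[d21 E21] c12 c21.
subst u1 u2 u12 u21.
exact: (@derive_comm n u e1 e2 x d1 d2 d12 d21 c12 c21).
Qed.

End coordinate_derivatives.

Lemma iter_stable (T : Type) (P : T -> Prop) (u : T -> T) k x :
  (forall y, P y -> P (u y)) -> P x -> P (iter k u x).
Proof. by move=> uP Px; elim: k => //= k; exact: uP. Qed.

Lemma iter_commute (T : Type) (P : T -> Prop) (u v : T -> T) p q x :
  (forall y, P y -> P (u y)) -> (forall y, P y -> P (v y)) ->
  (forall y, P y -> u (v y) = v (u y)) -> P x ->
  iter p u (iter q v x) = iter q v (iter p u x).
Proof.
move=> uP vP uv Px; elim: q => //= q <-.
elim: p => //= p ->; apply: uv.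
by do 2?apply: iter_stable.
Qed.

Section smooth_functions.
Variables (R : realType) (n : nat).
Local Notation C := (Cplx R).
Local Notation F := (cfun R n).
Local Notation Re := complex.Re.
Local Notation Im := complex.Im.
Implicit Types (f g : F) (j : 'I_n) (x : 'rV[R]_n).

Lemma continuous_Re f : continuous f -> continuous (fun y => Re (f y)).
Proof. by move=> cf x; exact: (@cvg_Re _ _ _ _ f _ (cf x)). Qed.

Lemma continuous_Im f : continuous f -> continuous (fun y => Im (f y)).
Proof. by move=> cf x; exact: (@cvg_Im _ _ _ _ f _ (cf x)). Qed.

Definition clin (a b : C) f g : F := fun x => a * f x + b * g x.

Definition cderivable f j x : Prop :=
  derivable (fun y => Re (f y)) x (delta_mx 0 j) /\
  derivable (fun y => Im (f y)) x (delta_mx 0 j).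

Let is_derive_lin (k l : R) (u v : 'rV[R]_n -> R) x e du dv :
  is_derive x e u du -> is_derive x e v dv ->
  is_derive x e (fun y => k * u y + l * v y) (k * du + l * dv).
Proof. by move=> hu hv; apply: is_deriveD; exact: is_deriveZ. Qed.

Let is_derive_Re (a b : C) f g j x : cderivable f j x -> cderivable g j x ->
  is_derive x (delta_mx 0 j) (fun y => Re (clin a b f g y))
    (Re (a * partialC j f x + b * partialC j g x)).
Proof.
move=> [/derivableP fr /derivableP fi] [/derivableP gr /derivableP gi].
have := is_derive_lin 1 1 (is_derive_lin (Re a) (- Im a) fr fi)
  (is_derive_lin (Re b) (- Im b) gr gi).
rewrite /clin ReD !ReM /= !mul1r !mulNr.
suff -> : (fun y => 1 * (Re a * Re (f y) + - Im a * Im (f y)) +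
    1 * (Re b * Re (g y) + - Im b * Im (g y))) =
    (fun y => Re (a * f y + b * g y)) by [].
by apply/funext => y; rewrite ReD !ReM !mul1r !mulNr.
Qed.

Let is_derive_Im (a b : C) f g j x : cderivable f j x -> cderivable g j x ->
  is_derive x (delta_mx 0 j) (fun y => Im (clin a b f g y))
    (Im (a * partialC j f x + b * partialC j g x)).
Proof.
move=> [/derivableP fr /derivableP fi] [/derivableP gr /derivableP gi].
have := is_derive_lin 1 1 (is_derive_lin (Re a) (Im a) fi fr)
  (is_derive_lin (Re b) (Im b) gi gr).
rewrite /clin ImD !ImM /= !mul1r.
suff -> : (fun y => 1 * (Re a * Im (f y) + Im a * Re (f y)) +
    1 * (Re b * Im (g y) + Im b * Re (g y))) =
    (fun y => Im (a * f y + b * g y)) by [].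
by apply/funext => y; rewrite ImD !ImM !mul1r.
Qed.

Lemma cderivable_lin (a b : C) f g j x : cderivable f j x -> cderivable g j x ->
  cderivable (clin a b f g) j x.
Proof.
move=> df dg; split.
  by have [] := is_derive_Re a b df dg.
by have [] := is_derive_Im a b df dg.
Qed.

Lemma partialC_lin (a b : C) f g j x : cderivable f j x -> cderivable g j x ->
  partialC j (clin a b f g) x = a * partialC j f x + b * partialC j g x.
Proof.
move=> df dg; apply: cplx_ext.
  by have [_ <-] := is_derive_Re a b df dg.
by have [_ <-] := is_derive_Im a b df dg.
Qed.

Lemma smooth_cderivable f : smooth f -> forall j x, cderivable f j x.
Proof. by move=> sf j x; have [_ /(_ x j)] := sf [::]. Qed.

Lemma smooth_continuous f : smooth f -> continuous f.
Proof. by move=> sf; have [] := sf [::]. Qed.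

Lemma smooth_partialC f j : smooth f -> smooth (partialC j f).
Proof. by move=> sf s; have := sf (rcons s j); rewrite /= foldr_rcons. Qed.

Lemma foldr_partialC_lin (a b : C) f g s : smooth f -> smooth g ->
  foldr (@partialC R n) (clin a b f g) s =
  clin a b (foldr (@partialC R n) f s) (foldr (@partialC R n) g s).
Proof.
move=> sf sg; elim: s => //= j s ->; apply/funext => x.
by rewrite partialC_lin//; [have [_] := sf s|have [_] := sg s]; apply.
Qed.

Lemma continuous_clin (a b : C) f g : continuous f -> continuous g ->
  continuous (clin a b f g).
Proof.
move=> cf cg x.
exact: (cvgD (cvgM (cvg_cst a) (cf x)) (cvgM (cvg_cst b) (cg x))).
Qed.

Lemma smooth_clin (a b : C) f g : smooth f -> smooth g -> smooth (clin a b f g).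
Proof.
move=> sf sg s; rewrite foldr_partialC_lin//.
have [cf df] := sf s; have [cg dg] := sg s.
split; first exact: continuous_clin.
by move=> x j; apply: cderivable_lin; [exact: df|exact: dg].
Qed.

Let Dj_clin0 f j : Dj j f = clin (imC R)^-1 0 (partialC j f) (partialC j f).
Proof. by apply/funext => x; rewrite /Dj /clin mul0r addr0. Qed.

Lemma smooth_Dj f j : smooth f -> smooth (Dj j f).
Proof. by move=> sf; rewrite Dj_clin0; apply: smooth_clin; exact: smooth_partialC. Qed.

Lemma Dj_clin (a b : C) f g j : smooth f -> smooth g ->
  Dj j (clin a b f g) = clin a b (Dj j f) (Dj j g).
Proof.
move=> sf sg; apply/funext => x; rewrite /Dj partialC_lin; [|exact: smooth_cderivable..].
by rewrite /clin mulrDr mulrCA [in X in _ + X]mulrCA.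
Qed.

Lemma partialC_comm f i j : smooth f ->
  partialC i (partialC j f) = partialC j (partialC i f).
Proof.
move=> sf; apply/funext => x.
have cc k l : continuous (partialC k (partialC l f)).
  exact: (smooth_continuous (smooth_partialC k (smooth_partialC l sf))).
have sk k := smooth_partialC k sf.
apply: cplx_ext.
  apply: (@is_derive_comm R n (fun y => Re (f y)) (fun y => Re (partialC j f y))
    (fun y => Re (partialC i f y)) (fun y => Re (partialC i (partialC j f) y))
    (fun y => Re (partialC j (partialC i f) y)) (delta_mx 0 j) (delta_mx 0 i) x).
  - by move=> y; exact: (derivableP (smooth_cderivable sf j y).1).
  - by move=> y; exact: (derivableP (smooth_cderivable sf i y).1).
  - by move=> y; exact: (derivableP (smooth_cderivable (sk j) i y).1).
  - by move=> y; exact: (derivableP (smooth_cderivable (sk i) j y).1).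
  - exact: continuous_Re (cc i j).
  - exact: continuous_Re (cc j i).
apply: (@is_derive_comm R n (fun y => Im (f y)) (fun y => Im (partialC j f y))
  (fun y => Im (partialC i f y)) (fun y => Im (partialC i (partialC j f) y))
  (fun y => Im (partialC j (partialC i f) y)) (delta_mx 0 j) (delta_mx 0 i) x).
- by move=> y; exact: (derivableP (smooth_cderivable sf j y).2).
- by move=> y; exact: (derivableP (smooth_cderivable sf i y).2).
- by move=> y; exact: (derivableP (smooth_cderivable (sk j) i y).2).
- by move=> y; exact: (derivableP (smooth_cderivable (sk i) j y).2).
- exact: continuous_Im (cc i j).
- exact: continuous_Im (cc j i).
Qed.

Let Dj_Dj f i j : smooth f ->
  Dj i (Dj j f) = fun x => (imC R)^-1 * ((imC R)^-1 * partialC i (partialC j f) x).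
Proof.
move=> sf; have sj := smooth_partialC j sf.
rewrite (Dj_clin0 f j) (Dj_clin _ _ i sj sj).
by apply/funext => x; rewrite /clin mul0r addr0.
Qed.

Lemma Dj_comm f i j : smooth f -> Dj i (Dj j f) = Dj j (Dj i f).
Proof. by move=> sf; rewrite (Dj_Dj i j sf) (Dj_Dj j i sf) partialC_comm. Qed.

Lemma smooth_iter_Dj f j k : smooth f -> smooth (iter k (Dj j) f).
Proof. by move=> sf; apply: iter_stable sf => g; exact: smooth_Dj. Qed.

Lemma iter_Dj_comm f i j p q : smooth f ->
  iter p (Dj i) (iter q (Dj j) f) = iter q (Dj j) (iter p (Dj i) f).
Proof.
by apply: iter_commute => g; [exact: smooth_Dj|exact: smooth_Dj|exact: Dj_comm].
Qed.

Let Dseq (a : mindex n) f s := foldr (fun j g => iter (a j) (Dj j) g) f s.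

Lemma Dmulti_clin (a b : C) f g (al : mindex n) : smooth f -> smooth g ->
  Dmulti al (clin a b f g) = clin a b (Dmulti al f) (Dmulti al g).
Proof.
move=> sf sg; rewrite /Dmulti.
suff: [/\ smooth (Dseq al f (enum 'I_n)), smooth (Dseq al g (enum 'I_n)) &
  Dseq al (clin a b f g) (enum 'I_n) =
  clin a b (Dseq al f (enum 'I_n)) (Dseq al g (enum 'I_n))] by case.
elim: (enum _) => [|j s [sf' sg' E]]; first by split; [exact: sf|exact: sg|exact: erefl].
split; [exact: (smooth_iter_Dj j _ sf')|exact: (smooth_iter_Dj j _ sg')|].
rewrite [LHS]/Dseq /= -/(Dseq _ _ _) E.
have iter_clin k : iter k (Dj j) (clin a b (Dseq al f s) (Dseq al g s)) =
    clin a b (iter k (Dj j) (Dseq al f s)) (iter k (Dj j) (Dseq al g s)).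
  elim: k => [|k IH]; first exact: erefl.
  by rewrite !iterS IH (Dj_clin _ _ j (smooth_iter_Dj j k sf') (smooth_iter_Dj j k sg')).
exact: iter_clin.
Qed.

Definition mindex2 (i j : 'I_n) (p q : nat) : mindex n :=
  [ffun k => if k == i then p else if k == j then q else 0%N].

Lemma mlen_mindex2 i j p q : i != j -> mlen (mindex2 i j p q) = (p + q)%N.
Proof.
move=> ij; rewrite /mlen (bigD1 i)//= (bigD1 j) /=; last by rewrite eq_sym.
rewrite !ffunE eqxx [j == i]eq_sym (negbTE ij) eqxx big1 ?addn0//.
by move=> k /andP[ki kj]; rewrite ffunE (negbTE ki) (negbTE kj).
Qed.

(** [Dmulti] applies the derivatives in the order of the coordinates, whereas
    integrations by parts produce them in any order; the commutation of derivatives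
    reconciles the two. *)
Lemma Dmulti_mindex2 f i j p q : smooth f -> i != j ->
  Dmulti (mindex2 i j p q) f = iter p (Dj i) (iter q (Dj j) f).
Proof.
move=> sf ij; rewrite /Dmulti.
have : uniq (enum 'I_n) by exact: enum_uniq.
suff H s : uniq s -> Dseq (mindex2 i j p q) f s =
    iter (if i \in s then p else 0%N) (Dj i)
      (iter (if j \in s then q else 0%N) (Dj j) f).
  by move=> u; rewrite -/(Dseq _ _ _) H// !mem_enum.
elim: s => [|k s IH]; first by move=> _; exact: erefl.
rewrite [uniq _]/= => /andP[ks us].
rewrite [LHS]/Dseq /= -/(Dseq _ _ _) IH// ffunE !in_cons.
have [ki|ki] := eqVneq k i.
  have ks' := ks; rewrite ki in ks' *.
  by rewrite [j == i]eq_sym (negbTE ij) /=; rewrite (negbTE ks') /=.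
have [kj|kj] := eqVneq k j.
  have ks' := ks; rewrite kj in ks' *.
  rewrite (negbTE ks') ?eqxx ?(negbTE ij) /=.
  exact: (iter_Dj_comm j i q _ sf).
by rewrite ?[i == k]eq_sym ?[j == k]eq_sym ?(negbTE ki) ?(negbTE kj) /=.
Qed.

Definition vanishes_off (S : set 'rV[R]_n) f := forall x, ~ S x -> f x = 0.

Lemma vanishes_off_Dj S f j : closed S -> vanishes_off S f ->
  vanishes_off S (Dj j f).
Proof.
move=> cS f0 x Sx; rewrite /Dj.
have nS : nbhs x (~` S) by apply: open_nbhs_nbhs; split => //; exact: closed_openC.
have nRe : \forall y \near x, Re (f y) = cst 0 y by apply: filterS nS => y /f0 ->.
have nIm : \forall y \near x, Im (f y) = cst 0 y by apply: filterS nS => y /f0 ->.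
have -> : partialC j f x = 0.
  by rewrite /partialC (near_eq_derive _ nRe) (near_eq_derive _ nIm) !derive_cst.
by rewrite mulr0.
Qed.

Lemma vanishes_off_iter_Dj S f j k : closed S -> vanishes_off S f ->
  vanishes_off S (iter k (Dj j) f).
Proof. by move=> cS f0; apply: iter_stable f0 => g; exact: vanishes_off_Dj. Qed.

End smooth_functions.

(** * Integrands supported in a cube *)

Section compact_support.
Variables (R : realType) (n : nat).
Local Notation C := (Cplx R).
Local Notation F := (cfun R n).
Local Notation Re := complex.Re.
Local Notation Im := complex.Im.
Local Notation mu := (lebesgue_rV R n).
Implicit Types (f g : F) (r : R).

Definition cube_volume r : R := fine (mu (cube r)).

Lemma cube_volume_ge0 r : 0 <= cube_volume r.
Proof. exact: fine_ge0. Qed.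

Lemma compact_cube r : compact (@cube R n r).
Proof.
apply: bounded_closed_compact; last exact: closed_cube.
exists r; split; first exact: num_real.
by move=> M rM x /= xr; rewrite (le_trans xr)// ltW.
Qed.

Lemma integrable_cube (Q r : R) : 0 <= r ->
  mu.-integrable setT (EFin \o (fun x => Q * \1_(cube r) x)).
Proof.
move=> r0; apply: (integrableZl measurableT Q (f := fun x => (\1_(cube r) x)%:E)).
apply/integrableP; split.
  by apply/measurable_EFinP; apply: measurable_indic; exact: measurable_cube.
rewrite (eq_integral (fun x => (\1_(cube r) x)%:E)); last first.
  by move=> x _; rewrite gee0_abs// lee_fin.
by rewrite integral_indic ?setIT//; [exact: lebesgue_cube_lty|exact: measurable_cube].
Qed.

Lemma Rintegral_cube (Q r : R) : 0 <= r ->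
  Rintegral mu setT (fun x => Q * \1_(cube r) x) = Q * cube_volume r.
Proof.
move=> r0; rewrite RintegralZl//; last first.
  have := integrable_cube 1 r0; apply: eq_integrable => // x _.
  by rewrite /= mul1r.
congr (_ * _); rewrite /Rintegral integral_indic ?setIT//; exact: measurable_cube.
Qed.

Let cube_dominated (Q r : R) f : vanishes_off (cube r) f ->
  (forall x, `|x| <= r -> modC (f x) <= Q) ->
  forall x, modC (f x) <= Q * \1_(cube r) x.
Proof.
move=> f0 fQ x; rewrite indicE; case: (boolP (x \in _)) => [|]; rewrite ?inE.
  by move=> xr; rewrite mulr1; exact: fQ.
by move=> /negP; rewrite inE => /f0 ->; rewrite modC0 mulr0.
Qed.

Lemma cintegrable_cube (Q r : R) f : 0 <= r -> cmeasurable f ->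
  vanishes_off (cube r) f -> (forall x, `|x| <= r -> modC (f x) <= Q) ->
  cintegrable mu f.
Proof.
move=> r0 mf f0 fQ; apply: (cintegrable_dominated mf (integrable_cube Q r0)).
exact: cube_dominated.
Qed.

Lemma modC_cintegral_cube_le (Q r : R) f : 0 <= r -> cmeasurable f ->
  vanishes_off (cube r) f -> (forall x, `|x| <= r -> modC (f x) <= Q) ->
  modC (cintegral mu f) <= 2 * (Q * cube_volume r).
Proof.
move=> r0 mf f0 fQ; rewrite -Rintegral_cube//.
apply: (modC_cintegral_le mf (integrable_cube Q r0)).
exact: cube_dominated.
Qed.

Lemma cintegral_shift f (w : 'rV[R]_n) : cmeasurable f -> cintegrable mu f ->
  cintegral mu (fun x => f (x + w)) = cintegral mu f.
Proof.
move=> [mr mi] [fr fi]; apply: cplx_ext => /=.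
  exact: (Rintegral_rV_shift w mr fr).
exact: (Rintegral_rV_shift w mi fi).
Qed.

Lemma continuous_cube_bounded f r : continuous f ->
  exists2 Q, 0 <= Q & forall x, `|x| <= r -> modC (f x) <= Q.
Proof.
move=> cf; pose N x := `|Re (f x)| + `|Im (f x)|.
have cN : continuous N.
  move=> x.
  exact: (cvgD (cvg_norm (@continuous_Re _ _ f cf x)) (cvg_norm (@continuous_Im _ _ f cf x))).
have [r0|r0] := leP 0 r; last first.
  by exists 0 => // x xr; have := le_lt_trans xr r0; rewrite normr_lt0.
have [c _ cmax] := @compact_EVT_max _ R N (cube r)
  (ex_intro _ 0 (eq_ind_r (fun z => z <= r) r0 (normr0 _)))
  (@compact_cube r) (continuous_subspaceT cN).
exists (N c); first by rewrite addr_ge0.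
by move=> x xr; rewrite (le_trans (modC_le _))// cmax// inE.
Qed.

Lemma vanishes_off_bounded f r : continuous f -> vanishes_off (cube r) f ->
  exists2 Q, 0 <= Q & forall x, modC (f x) <= Q.
Proof.
move=> /(@continuous_cube_bounded _ r)[Q Q0 fQ] f0; exists Q => // x.
have [xr|xr] := leP `|x| r; first exact: fQ.
rewrite f0 ?modC0// /cube /=; apply/negP; by rewrite -ltNge.
Qed.

End compact_support.

(** * Integration by parts along an oscillating direction *)

Section difference_quotients.
Variables (R : realType) (n : nat).
Local Notation C := (Cplx R).
Local Notation Re := complex.Re.
Local Notation Im := complex.Im.
Implicit Types (u ui uj : 'rV[R]_n -> R) (ei ej x : 'rV[R]_n).

Let step (k : nat) : R := k.+1%:R^-1.

Let step_gt0 k : 0 < step k. Proof. by rewrite invr_gt0. Qed.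

Let step_cvg : step @ \oo --> 0. Proof. exact: cvg_harmonic. Qed.

(** The increment in direction [ei - ej] is split at [x - t *: ej], so that the mean
    value theorem applies along [ei] and along [ej] separately. *)
Lemma difference_quotient u ui uj ei ej x (t : R) : 0 < t ->
  (forall y, is_derive y ei u (ui y)) -> (forall y, is_derive y ej u (uj y)) ->
  exists y z, [/\ `|y| <= t * (`|ei| + `|ej|), `|z| <= t * (`|ei| + `|ej|) &
    t^-1 * (u (x + t *: (ei - ej)) - u x) = ui (y + x) - uj (z + x)].
Proof.
move=> t0 di dj; pose w := x - t *: ej.
have [s /andP[s0 st] Es] := @coord_MVT R n u w ei t (ltW t0)
  (fun y => @ex_derive _ _ _ _ _ _ _ (di y)).
have [q /andP[q0 qt] Eq] := @coord_MVT R n u w ej t (ltW t0)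
  (fun y => @ex_derive _ _ _ _ _ _ _ (dj y)).
exists (s *: ei - t *: ej), (q *: ej - t *: ej); split.
- rewrite (le_trans (ler_normB _ _))// !normrZ mulrDr lerD//.
    by rewrite ler_wpM2r// ger0_norm.
  by rewrite gtr0_norm.
- rewrite -scalerBl normrZ ler_pM//; last by rewrite lerDr.
  by rewrite ler_norml; apply/andP; split; lra.
have xw : t *: ej + w = x by rewrite /w addrC subrK.
have xiw : t *: ei + w = x + t *: (ei - ej).
  by rewrite /w scalerBr addrCA.
rewrite xw in Eq; rewrite xiw in Es.
rewrite (@derive_val _ _ _ _ _ _ _ (di _)) in Es.
rewrite (@derive_val _ _ _ _ _ _ _ (dj _)) in Eq.
have -> : s *: ei - t *: ej + x = s *: ei + w by rewrite /w addrAC addrA.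
have -> : q *: ej - t *: ej + x = q *: ej + w by rewrite /w addrAC addrA.
have -> : u (x + t *: (ei - ej)) - u x =
    (u (x + t *: (ei - ej)) - u w) - (u x - u w) by rewrite opprB addrA subrK.
by rewrite Es Eq -mulrBr mulKf// gt_eqF.
Qed.

Lemma difference_quotient_cvg u ui uj ei ej x :
  (forall y, is_derive y ei u (ui y)) -> (forall y, is_derive y ej u (uj y)) ->
  continuous ui -> continuous uj ->
  (fun k => (step k)^-1 * (u (x + step k *: (ei - ej)) - u x)) @ \oo -->
  ui x - uj x.
Proof.
move=> di dj ci cj; apply/cvgrPdist_lt => e e0.
have e20 : 0 < e / 2 by rewrite divr_gt0.
have [r1 r10 h1] := continuous_rVP x ci e20.
have [r2 r20 h2] := continuous_rVP x cj e20.
pose m := 1 + (`|ei| + `|ej|).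
have m0 : 0 < m by rewrite /m ltr_wpDr// addr_ge0.
have small : \forall k \near \oo, step k * m <= Num.min r1 r2.
  have /cvgrPdist_le/(_ (Num.min r1 r2 / m)) := step_cvg.
  rewrite divr_gt0// ?lt_min ?r10// => /(_ isT); apply: filterS => k.
  by rewrite sub0r normrN gtr0_norm// ler_pdivlMr.
apply: filterS small => k; rewrite le_min => /andP[k1 k2].
have [y [z [yle zle ->]]] := difference_quotient x (step_gt0 k) di dj.
have kle : step k * (`|ei| + `|ej|) <= step k * m.
  by rewrite ler_pM2l// lerDr.
have := h1 y (le_trans yle (le_trans kle k1)).
have := h2 z (le_trans zle (le_trans kle k2)).
move=> b a; rewrite (splitr e).
have regroup (p q p' q' : R) : p - q - (p' - q') = (q' - q) - (p' - p) by ring.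
rewrite regroup.
by rewrite (le_lt_trans (ler_normB _ _))// ltrD.
Qed.

Lemma derivative_seq (g : R -> R) (l : R) : is_derive (0 : R) 1 g l ->
  (fun k => (step k)^-1 * (g (step k) - g 0)) @ \oo --> l.
Proof.
move=> [dg gl].
have : (fun h => h^-1 *: ((g \o shift 0) (h *: 1) - g 0)) @ (0:R)^' --> l.
  by rewrite -gl; exact: dg.
move=> /cvgr_dnbhsP /(_ step) H.
have := H (conj (fun k => lt0r_neq0 (step_gt0 k)) step_cvg).
by under eq_fun do rewrite /= addr0 [step _ *: 1]mulr1.
Qed.

Lemma cexp_quotient_cvg (c : R) :
  (fun k => ((step k)^-1)%:C%C * (cexp (imC R * (c * step k)%:C%C) - 1) : C) @ \oo -->
  (imC R * c%:C%C).
Proof.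
apply: cvg_cplx.
  have -> : Re (imC R * c%:C%C) = 0 by rewrite ReM /=; ring.
  have D : is_derive (0 : R) 1 (fun t : R => cos (c * t)) 0.
    have dl : is_derive (0 : R) 1 ( *%R c) c.
      have := @is_deriveZ _ _ _ id c (0 : R) 1 1 (is_derive_id _ _).
      by rewrite [c *: 1]mulr1.
    have := @is_derive1_comp _ cos ( *%R c) 0 _ _ (is_derive_cos _) dl.
    by rewrite mulr0 sin0 oppr0 mul0r.
  suff -> : (fun k => Re (((step k)^-1)%:C%C * (cexp (imC R * (c * step k)%:C%C) - 1))) =
    (fun k => (step k)^-1 * (cos (c * step k) - cos (c * 0))) by exact: derivative_seq.
  by apply/funext => k; rewrite ReM ReD ReN cexp_imC mulr0 cos0 /= mul0r subr0.
have -> : Im (imC R * c%:C%C) = c by rewrite ImM /=; ring.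
have D : is_derive (0 : R) 1 (fun t : R => sin (c * t)) c.
  have dl : is_derive (0 : R) 1 ( *%R c) c.
    have := @is_deriveZ _ _ _ id c (0 : R) 1 1 (is_derive_id _ _).
    by rewrite [c *: 1]mulr1.
  have := @is_derive1_comp _ sin ( *%R c) 0 _ _ (is_derive_sin _) dl.
  by rewrite mulr0 cos0 mul1r.
suff -> : (fun k => Im (((step k)^-1)%:C%C * (cexp (imC R * (c * step k)%:C%C) - 1))) =
  (fun k => (step k)^-1 * (sin (c * step k) - sin (c * 0))) by exact: derivative_seq.
by apply/funext => k; rewrite ImM ImD ImN cexp_imC mulr0 sin0 /= mul0r addr0.
Qed.

End difference_quotients.

(** [A] stands for the oscillating factor of the kernel at a fixed frequency, and
    [ei - ej] for a direction along which its modulus is constant and its phase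
    rotates at speed [2 eta]. *)
Section integration_by_parts.
Variables (R : realType) (n : nat) (i j : 'I_n) (eta r B : R) (A : cfun R n).
Local Notation C := (Cplx R).
Local Notation Re := complex.Re.
Local Notation Im := complex.Im.
Local Notation mu := (lebesgue_rV R n).
Local Notation ei := (delta_mx 0 i : 'rV[R]_n).
Local Notation ej := (delta_mx 0 j : 'rV[R]_n).
Hypothesis r0 : 0 <= r.
Hypothesis mA : cmeasurable A.
Hypothesis A_phase : forall t X,
  A (X + t *: (ei - ej)) = cexp (imC R * (2 * eta * t)%:C%C) * A X.
Hypothesis A_bound : forall X, `|X| <= r + 2 -> modC (A X) <= B.
Implicit Types f : cfun R n.

Definition pairing f : C := cintegral mu (fun X => A X * f X).

Let A_bound0 X : `|X| <= r -> modC (A X) <= B.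
Proof. by move=> Xr; apply: A_bound; rewrite (le_trans Xr)// lerDl. Qed.

Lemma cmeasurable_integrand f : continuous f -> cmeasurable (fun X => A X * f X).
Proof. by move=> cf; apply: cmeasurableM => //; exact: continuous_cmeasurable. Qed.

Let vanishes_offM f : vanishes_off (cube r) f ->
  vanishes_off (cube r) (fun X => A X * f X).
Proof. by move=> f0 x /f0 ->; rewrite mulr0. Qed.

Lemma cintegrable_integrand f : continuous f -> vanishes_off (cube r) f ->
  cintegrable mu (fun X => A X * f X).
Proof.
move=> cf f0; have [Q Q0 fQ] := vanishes_off_bounded cf f0.
apply: (@cintegrable_cube _ _ (B * Q) r) => //.
- exact: cmeasurable_integrand.
- exact: vanishes_offM.
- by move=> x xr; rewrite modCM ler_pM ?modC_ge0// A_bound0.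
Qed.

Lemma modC_pairing_le f Q : continuous f -> vanishes_off (cube r) f ->
  (forall x, modC (f x) <= Q) -> modC (pairing f) <= 2 * (B * Q * cube_volume n r).
Proof.
move=> cf f0 fQ; apply: modC_cintegral_cube_le => //.
- exact: cmeasurable_integrand.
- exact: vanishes_offM.
- by move=> x xr; rewrite modCM ler_pM ?modC_ge0// A_bound0.
Qed.

Lemma pairing_clin f g a b : continuous f -> continuous g ->
  vanishes_off (cube r) f -> vanishes_off (cube r) g ->
  pairing (clin a b f g) = a * pairing f + b * pairing g.
Proof.
move=> cf cg f0 g0; rewrite /pairing.
have fi := cintegrable_integrand cf f0; have gi := cintegrable_integrand cg g0.
rewrite -(cintegralZ a fi) -(cintegralZ b gi) -cintegralD; [|exact: cintegrableZ..].
congr cintegral; apply/funext => X; rewrite /clin; ring.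
Qed.

Let normr_delta (k : 'I_n) : `|delta_mx 0 k : 'rV[R]_n| <= 1.
Proof.
apply/rV_norm_leP => // l; rewrite mxE eqxx /=.
by case: (l == k); rewrite ?normr1 ?normr0.
Qed.

Let step (k : nat) : R := k.+1%:R^-1.

Let step_gt0 k : 0 < step k. Proof. by rewrite invr_gt0. Qed.

Let step_le1 k : step k <= 1.
Proof. by rewrite invf_le1// ler1n. Qed.

Let shift_le k : `|step k *: (ei - ej)| <= 2.
Proof.
rewrite normrZ gtr0_norm//; have e2 : `|ei - ej| <= 1 + 1.
  by rewrite (le_trans (ler_normB _ _))// lerD.
by rewrite (le_trans (ler_piMl _ (step_le1 k))).
Qed.

Section one_step.
Variable f : cfun R n.
Hypotheses (sf : smooth f) (f0 : vanishes_off (cube r) f).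

Let quotient k : cfun R n := fun X =>
  A X * (((step k)^-1)%:C%C * (f (X + step k *: (ei - ej)) - f X)).

Let fi : cintegrable mu (fun X => A X * f X).
Proof. by apply: cintegrable_integrand => //; exact: smooth_continuous. Qed.

Let mAf : cmeasurable (fun X => A X * f X).
Proof. by apply: cmeasurable_integrand; exact: smooth_continuous. Qed.

Let vanishes_shift k (g : cfun R n) : vanishes_off (cube r) g ->
  vanishes_off (cube (r + 2)) (fun X => g (X + step k *: (ei - ej))).
Proof.
move=> g0 X /negP; rewrite /cube /= -ltNge => rX; apply: g0 => /=; apply/negP.
rewrite -ltNge -(ltrD2r 2) (lt_le_trans rX)//.
rewrite -{1}(addrK (step k *: (ei - ej)) X) (le_trans (ler_normB _ _))//.
by rewrite lerD2l.
Qed.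

Let fi_shift k : cintegrable mu
  (fun X => A (X + step k *: (ei - ej)) * f (X + step k *: (ei - ej))).
Proof.
have [Q Q0 fQ] := vanishes_off_bounded (smooth_continuous sf) f0.
apply: (@cintegrable_cube _ _ (B * Q) (r + 2)); first by rewrite addr_ge0.
- exact: (cmeasurable_comp mAf (measurable_rV_shift _)).
- exact: (vanishes_shift k (vanishes_offM f0)).
- move=> x xr; rewrite modCM A_phase modCM modC_cexp_imC mul1r.
  by rewrite ler_pM ?modC_ge0// A_bound.
Qed.

Let cintegral_quotient k : cintegral mu (quotient k) =
  (((step k)^-1)%:C%C * (cexp (imC R * (- (2 * eta) * step k)%:C%C) - 1)) * pairing f.
Proof.
set c := cexp _; set s := ((step k)^-1)%:C%C.
have Ac X : A X = c * A (X + step k *: (ei - ej)).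
  rewrite A_phase mulrA /c -cexp_imCD mulNr addNr.
  have -> : cexp (imC R * (0 : R)%:C%C) = 1 by rewrite cexp_imC cos0 sin0.
  by rewrite mul1r.
transitivity (cintegral mu (fun X =>
    (s * c) * (A (X + step k *: (ei - ej)) * f (X + step k *: (ei - ej))) +
    (- s) * (A X * f X))).
  congr cintegral; apply/funext => X; rewrite /quotient -/s.
  rewrite mulrBr mulrBr [A X * (s * f (X + _))]mulrA {1}Ac.
  by rewrite mulNr; congr (_ - _); ring.
rewrite cintegralD; [|exact: cintegrableZ..].
rewrite (cintegralZ _ (fi_shift k)) (cintegralZ _ fi).
rewrite (cintegral_shift (step k *: (ei - ej)) mAf fi) -/(pairing f).
by ring.
Qed.

Let isd_Re k y : is_derive y (delta_mx 0 k) (fun X => Re (f X)) (Re (partialC k f y)).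
Proof. exact: (derivableP (smooth_cderivable sf k y).1). Qed.

Let isd_Im k y : is_derive y (delta_mx 0 k) (fun X => Im (f X)) (Im (partialC k f y)).
Proof. exact: (derivableP (smooth_cderivable sf k y).2). Qed.

Let quotient_cvg X : quotient ^~ X @ \oo -->
  A X * (partialC i f X - partialC j f X).
Proof.
have cp k : continuous (partialC k f) := smooth_continuous (smooth_partialC k sf).
suff H : (fun k => ((step k)^-1)%:C%C * (f (X + step k *: (ei - ej)) - f X)) @ \oo -->
    partialC i f X - partialC j f X.
  exact: (cvgM (cvg_cst (A X)) H).
apply: cvg_cplx.
  rewrite ReD ReN.
  have := @difference_quotient_cvg _ _ _ _ _ ei ej X (isd_Re i) (isd_Re j)
    (continuous_Re (cp i)) (continuous_Re (cp j)).
  suff -> : (fun k => Re (((step k)^-1)%:C%C * (f (X + step k *: (ei - ej)) - f X))) =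
    (fun k => (step k)^-1 * (Re (f (X + step k *: (ei - ej))) - Re (f X))) by [].
  apply/funext => k.
  by rewrite ReM ReD ReN [Re _%:C%C]/= [Im _%:C%C]/= mul0r subr0.
rewrite ImD ImN.
have := @difference_quotient_cvg _ _ _ _ _ ei ej X (isd_Im i) (isd_Im j)
  (continuous_Im (cp i)) (continuous_Im (cp j)).
suff -> : (fun k => Im (((step k)^-1)%:C%C * (f (X + step k *: (ei - ej)) - f X))) =
  (fun k => (step k)^-1 * (Im (f (X + step k *: (ei - ej))) - Im (f X))) by [].
apply/funext => k.
by rewrite ImM ImD ImN [Re _%:C%C]/= [Im _%:C%C]/= mul0r addr0.
Qed.

Let quotient_bound : exists Q, forall k X,
  modC (quotient k X) <= Q * \1_(cube (r + 2)) X.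
Proof.
have sp k : exists2 Q, 0 <= Q & forall X, modC (partialC k f X) <= Q.
  have cp : continuous (Dj k f) := smooth_continuous (smooth_Dj k sf).
  have v := vanishes_off_Dj k (@closed_cube R n r) f0.
  have [Q Q0 h] := vanishes_off_bounded cp v; exists Q => // X.
  have := h X; rewrite /Dj modCM.
  have -> : modC ((imC R)^-1) = 1.
    rewrite /modC Normc.normcV -[Normc.normc _]/(modC (imC R)).
    suff -> : modC (imC R) = 1 by rewrite invr1.
    apply/eqP; rewrite -(eqrXn2 (n := 2)) ?modC_ge0// modC_sqr /= expr1n expr0n.
    by rewrite add0r.
  by rewrite mul1r.
have [P P0 hP] := sp i; have [Q Q0 hQ] := sp j.
exists (B * (2 * (P + Q))) => k X.
have [XC|XC] := pselect (cube (r + 2) X); last first.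
  rewrite indicE memNset// mulr0 /quotient (vanishes_shift k f0 XC) f0.
    by rewrite subr0 !mulr0 modC0.
  by move=> Xr; apply: XC; rewrite /cube/= (le_trans Xr)// lerDl.
rewrite indicE mem_set// mulr1 /quotient modCM ler_pM ?modC_ge0//; first exact: A_bound.
rewrite (le_trans (modC_le _))// mulr_natl mulr2n lerD//.
  rewrite ReM ReD ReN [Re _%:C%C]/= [Im _%:C%C]/= mul0r subr0.
  have [y [z [_ _ ->]]] := difference_quotient X (step_gt0 k) (isd_Re i) (isd_Re j).
  rewrite (le_trans (ler_normB _ _))// lerD// (le_trans (normr_Re_le _))//.
rewrite ImM ImD ImN [Re _%:C%C]/= [Im _%:C%C]/= mul0r addr0.
have [y [z [_ _ ->]]] := difference_quotient X (step_gt0 k) (isd_Im i) (isd_Im j).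
by rewrite (le_trans (ler_normB _ _))// lerD// (le_trans (normr_Im_le _)).
Qed.

Let cmeasurable_quotient k : cmeasurable (quotient k).
Proof.
have mf : cmeasurable f by apply: continuous_cmeasurable; exact: smooth_continuous.
apply: cmeasurableM => //; apply: cmeasurableM; first exact: cmeasurable_cst.
under eq_fun do rewrite -mulN1r.
apply: cmeasurableD.
  exact: (cmeasurable_comp mf (measurable_rV_shift _)).
by apply: cmeasurableM => //; exact: cmeasurable_cst.
Qed.

(** The integral of [A f] is invariant under translation by [t (ei - ej)]. Comparing
    it with its translate equates its product with the difference quotient of the
    phase to the integral of [A] against the difference quotient of [f]; then [t]
    tends to 0 along [1 / (k + 1)]. All derivatives fall on [f]. *)
Lemma pairing_by_parts :
  (- (2 * eta))%:C%C * pairing f = pairing (Dj i f) - pairing (Dj j f).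
Proof.
have [Q hQ] := quotient_bound.
have r20 : 0 <= r + 2 by rewrite addr_ge0.
have c1 := cintegral_cvg (mu := mu) cmeasurable_quotient (integrable_cube n Q r20)
  hQ quotient_cvg.
have c2 : (fun k => cintegral mu (quotient k)) @ \oo -->
    (imC R * (- (2 * eta))%:C%C) * pairing f.
  rewrite (funext cintegral_quotient).
  have H := @cexp_quotient_cvg R (- (2 * eta)).
  exact: (@cvgM _ _ _ _ _ _ _ _ H (cvg_cst (pairing f))).
have E : imC R * (- (2 * eta))%:C%C * pairing f =
    cintegral mu (fun X => A X * (partialC i f X - partialC j f X)).
  exact: (cvg_unique (@norm_hausdorff _ (Cplx R)) c2 c1).
have i0 : imC R != 0 by rewrite eq_complex /= oner_eq0 andbF.
apply: (mulfI i0); rewrite mulrA E.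
have cD k : continuous (Dj k f) := smooth_continuous (smooth_Dj k sf).
have vD k := vanishes_off_Dj k (@closed_cube R n r) f0.
have -> : pairing (Dj i f) - pairing (Dj j f) = pairing (clin 1 (-1) (Dj i f) (Dj j f)).
  by rewrite (pairing_clin 1 (-1) (cD i) (cD j) (vD i) (vD j)) mul1r mulN1r.
have V : vanishes_off (cube r) (clin 1 (-1) (Dj i f) (Dj j f)).
  by move=> x hx; rewrite /clin (vD i x hx) (vD j x hx) !mulr0 addr0.
have iD := cintegrable_integrand (@continuous_clin _ _ 1 (-1) _ _ (cD i) (cD j)) V.
rewrite -(cintegralZ (imC R) iD).
congr cintegral; apply/funext => X; rewrite /clin /Dj mul1r mulN1r -mulrBr.
by rewrite [RHS]mulrCA mulVKf.
Qed.

End one_step.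

(** Iterating [pairing_by_parts]: each factor [eta] costs one derivative of [f], in
    direction [i] or [j], and the factor 2 of the phase compensates for the choice
    between the two, so that no power of 2 accumulates. *)
Lemma pairing_decay f (N h : R) (M : nat -> R) : smooth f ->
  vanishes_off (cube r) f -> i != j ->
  (forall (al : mindex n) x, modC (Dmulti al f x) <= N * (h ^+ mlen al * M (mlen al))) ->
  forall p, `|eta| ^+ p * modC (pairing f) <=
    2 * (B * (N * (h ^+ p * M p)) * cube_volume n r).
Proof.
move=> sf f0 ij fN p.
have sm a b : smooth (iter a (Dj i) (iter b (Dj j) f)).
  by apply: smooth_iter_Dj; exact: smooth_iter_Dj.
have va a b : vanishes_off (cube r) (iter a (Dj i) (iter b (Dj j) f)).
  have cl := @closed_cube R n r.
  exact: (vanishes_off_iter_Dj i a cl (vanishes_off_iter_Dj j b cl f0)).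
suff H a b : `|eta| ^+ p * modC (pairing (iter a (Dj i) (iter b (Dj j) f))) <=
    2 * (B * (N * (h ^+ (a + b + p) * M (a + b + p)%N)) * cube_volume n r).
  exact: (H 0%N 0%N).
elim: p a b => [|p IH] a b.
  rewrite expr0 mul1r addn0; apply: modC_pairing_le.
  - exact: (smooth_continuous (sm a b)).
  - exact: va.
  - move=> x; rewrite -(Dmulti_mindex2 a b sf ij) -(mlen_mindex2 a b ij).
    exact: fN.
set g := iter a _ _.
have sg : smooth g := sm a b.
have g0 : vanishes_off (cube r) g := va a b.
have Ei : Dj i g = iter a.+1 (Dj i) (iter b (Dj j) f) by [].
have Ej : Dj j g = iter a (Dj i) (iter b.+1 (Dj j) f).
  rewrite /g -[Dj j (iter a _ _)]/(iter 1 (Dj j) (iter a (Dj i) (iter b (Dj j) f))).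
  by rewrite -(iter_Dj_comm i j a 1 (smooth_iter_Dj j b sf)).
have := pairing_by_parts sg g0.
move=> /(congr1 (@modC R)); rewrite modCM modCR normrN normrM ger0_norm// => E.
have H1 := IH a.+1 b; have H2 := IH a b.+1.
rewrite -Ei -Ej in H1 H2.
have EE : 2 * (`|eta| ^+ p.+1 * modC (pairing g)) <=
   `|eta| ^+ p * modC (pairing (Dj i g)) + `|eta| ^+ p * modC (pairing (Dj j g)).
  rewrite -mulrDr exprSr -mulrA mulrCA ler_wpM2l ?exprn_ge0// mulrA E.
  by rewrite (le_trans (le_modCD _ _))// modCN.
rewrite -(ler_pM2l (ltr0n R 2)) (le_trans EE)//.
rewrite [2 * (2 * _)]mulr_natl mulr2n lerD//.
  by move: H1; rewrite !addSn -addnS.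
by move: H2; rewrite addnS addSn -addnS.
Qed.

End integration_by_parts.

(** * Weight sequences *)

Section weights.
Variable R : realType.
Implicit Types (M P : nat -> R).

(** Up to the factor 2 the supremum defining the associated function is attained.
    If the set is unbounded, its [sup] is 0 by convention and [q = 0] will do. *)
Lemma expR_assoc_fun_le M (t : R) : (forall p, 0 < M p) -> M 0%N = 1 -> 0 <= t ->
  exists2 q, (t = 0 -> q = 0%N) & expR (assoc_fun M t) <= 2 * (t ^+ q / M q).
Proof.
move=> M0 M1 t0; rewrite /assoc_fun; set S := (X in sup X).
have [supS|/sup_out ->] := pselect (has_sup S); last first.
  exists 0%N => //; rewrite expR0 expr0 M1; lra.
have ln20 : 0 < ln (2 : R) by rewrite ln_gt0// ltr1n.
have [_ [q _ <-]] := sup_adherent ln20 supS; rewrite ltrBlDr /logp.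
have y0 : 0 <= t ^+ q / M q by rewrite divr_ge0 ?exprn_ge0// ltW.
have [y1|y1] := leP (t ^+ q / M q) 1.
  rewrite max_l ?ln_le0// add0r => /ltW sup2; exists 0%N => //.
  by rewrite expr0 M1 divr1 mulr1 -[leRHS]lnK ?posrE// ler_expR.
rewrite max_r; last by rewrite ln_ge0// ltW.
move=> /ltW supq; exists q.
  move=> t00; case: q y1 {y0 supq} => // q.
  by rewrite t00 expr0n /= mul0r ltr10.
rewrite mulrC -[X in _ <= X * _]lnK ?posrE ?(lt_trans ltr01)//.
by rewrite -[X in _ <= _ * X]lnK ?posrE// -expRD ler_expR.
Qed.

(** The quotients [c ^ q / (k 1 ... k q)] decrease as soon as [k q >= c]. *)
Lemma geometric_le_prod (k : nat -> R) (c : R) : incr_to_infty k -> 0 <= c ->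
  exists2 D, 0 <= D & forall q, c ^+ q <= D * \prod_(1 <= j < q.+1) k j.
Proof.
move=> [k0 kmono /cvgryPge kinf] c0.
have [J _ kJ] := kinf c.
pose Pr q := \prod_(1 <= j < q.+1) k j.
have Pr0 q : 0 < Pr q by apply: prodr_gt0.
pose D := \sum_(q < J.+1) c ^+ q / Pr q.
have term0 q : 0 <= c ^+ q / Pr q by rewrite divr_ge0 ?exprn_ge0// ltW.
exists D; first exact: sumr_ge0.
move=> q; rewrite -/(Pr q) -ler_pdivrMr//.
have small q' : (q' <= J)%N -> c ^+ q' / Pr q' <= D.
  move=> qJ; rewrite /D (bigD1 (Ordinal (qJ : (q' < J.+1)%N)))//= lerDl.
  exact: sumr_ge0.
have [qJ|/ltnW Jq] := leqP q J; first exact: small.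
rewrite -(subnK Jq); elim: (q - J)%N => [|m IH]; first exact: small.
apply: le_trans IH; rewrite addSn; set m' := (m + J)%N.
have -> : Pr m'.+1 = Pr m' * k m'.+1 by rewrite /Pr big_nat_recr.
have -> : c ^+ m'.+1 / (Pr m' * k m'.+1) = c ^+ m' / Pr m' * (c / k m'.+1).
  by rewrite exprSr; field; rewrite !gt_eqF.
rewrite ler_piMr// ler_pdivrMr// mul1r; apply: kJ => /=.
by rewrite leqW// leq_addl.
Qed.

(** Test functions whose derivatives of order [p] are of size [h ^ p M p] absorb the
    growth of [Bnd]: [q + l] integrations by parts, with [q] chosen in terms of [xi],
    compensate it and leave a decay of order [l]. The condition at [xi = 0] makes
    [`|xi| ^+ q] cancellable there too. *)
Definition tame M n (h : R) (Bnd : 'rV[R]_n -> R) : Prop :=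
  forall l, exists2 D, 0 <= D & forall xi, exists2 q, (xi = 0 -> q = 0%N) &
    Bnd xi * (h ^+ (q + l) * M (q + l)%N) <= D * `|xi| ^+ q.

(** (M.2) splits [M (q + l)] into [M q], which cancels the denominator of the growth
    term of index [q], and [M l], a constant. [P] is 1 in the Beurling case and the
    product of the first terms of [k] in the Roumieu case. *)
Lemma tame_of_series M P n (c0 H h C1 c D : R) (Bnd : 'rV[R]_n -> R) :
  (forall p, 0 < M p) -> (forall p, 0 < P p) -> cond_M2 M c0 H ->
  0 <= c0 -> 0 <= H -> 0 <= h -> 0 <= C1 -> 0 <= c ->
  (forall q, (c * h * H) ^+ q <= D * P q) ->
  (forall xi, exists2 q, (xi = 0 -> q = 0%N) & exists2 t, 0 <= t <= c * `|xi| &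
     Bnd xi <= C1 * (2 * (t ^+ q / (M q * P q)))) ->
  tame M h Bnd.
Proof.
move=> M0 P0 M2 c00 H0 h0 C10 c_ge0 cD hB l.
have D0 : 0 <= D.
  have := cD 0%N; rewrite expr0.
  by move=> /(le_trans ler01); rewrite pmulr_lge0.
have E0 : 0 <= 2 * C1 * c0 * ((h * H) ^+ l * M l).
  by rewrite !mulr_ge0// ?exprn_ge0 ?mulr_ge0// ltW.
exists (2 * C1 * c0 * ((h * H) ^+ l * M l) * D); first exact: mulr_ge0.
move=> xi; have [q xq [t /andP[t0 tc] Bq]] := hB xi; exists q => //.
have := M2 (q + l)%N l (leq_addl _ _); rewrite addnK => Mql.
have step1 : Bnd xi * (h ^+ (q + l) * M (q + l)%N) <=
    (C1 * (2 * (t ^+ q / (M q * P q)))) *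
    (h ^+ (q + l) * (c0 * H ^+ (q + l) * (M q * M l))).
  have hM0 : 0 <= h ^+ (q + l) * M (q + l)%N by rewrite mulr_ge0 ?exprn_ge0// ltW.
  apply: (le_trans (ler_wpM2r hM0 Bq)).
  rewrite ler_wpM2l// ?ler_wpM2l ?exprn_ge0//.
  by rewrite !mulr_ge0 ?invr_ge0 ?exprn_ge0// mulr_ge0// ltW.
rewrite (le_trans step1)//.
have Mq0 : M q != 0 by rewrite gt_eqF.
have Pq0 : P q != 0 by rewrite gt_eqF.
have -> : (C1 * (2 * (t ^+ q / (M q * P q)))) *
    (h ^+ (q + l) * (c0 * H ^+ (q + l) * (M q * M l)))
   = (2 * C1 * c0 * ((h * H) ^+ l * M l)) * ((t * (h * H)) ^+ q / P q).
  rewrite !exprMn !exprD; field.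
  by rewrite Pq0.
rewrite -[leRHS]mulrA ler_wpM2l// ler_pdivrMr// mulrAC.
rewrite (@le_trans _ _ ((c * h * H) ^+ q * `|xi| ^+ q))//; last first.
  by rewrite ler_wpM2r ?exprn_ge0.
rewrite -exprMn lerXn2r ?nnegrE ?mulr_ge0//.
rewrite (_ : c * h * H * `|xi| = (c * `|xi|) * (h * H)); last by ring.
by rewrite ler_wpM2r ?mulr_ge0.
Qed.

End weights.

(** * Fibre integrals of the Weyl kernel *)

Section real_trace.
Variables (R : realType) (n : nat).
Local Notation C := (Cplx R).

Lemma cvec_continuous : continuous (fun X : 'rV[R]_n => cvec X 0).
Proof.
move=> X; apply/(@cvg_ballP (Cplx R) _ _ _ (nbhs_filter X)) => _ /cplx_gt0_real[e e0 ->].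
apply/nbhs_ballP; exists e => //= Y XY.
split; first by rewrite ltcR.
move=> i j; rewrite (ord1 i) {i} !mxE /ball/= normr_modC.
have -> : (X 0 j +i* 0)%C - (Y 0 j +i* 0)%C = (X 0 j - Y 0 j)%:C%C :> C.
  by apply: cplx_ext; rewrite ?ReD ?ImD ?ReN ?ImN /= ?subr0.
rewrite modCR ltcR; have [_ /(_ 0 j)] := XY; exact.
Qed.

Lemma entire_trace_continuous (b : 'rV[C]_n -> C) : entire b ->
  continuous (fun X : 'rV[R]_n => b (cvec X 0)).
Proof.
move=> be X; apply: (@cvg_comp _ _ _ (fun X : 'rV[R]_n => cvec X 0) b).
  exact: cvec_continuous.
exact: (differentiable_continuous (be (cvec X 0))).
Qed.

End real_trace.

Section weyl_symbol.
Variables (R : realType) (d : nat) (b : 'rV[Cplx R]_(d + d) -> Cplx R).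
Local Notation C := (Cplx R).
Hypothesis b_entire : entire b.

Definition symbol (Z : 'rV[R]_(d + d)) : C := b (cvec Z 0).

Let symbol_continuous : continuous symbol.
Proof. exact: entire_trace_continuous. Qed.

Definition midpoint_arg (p : 'rV[R]_(d + d) * 'rV[R]_d) : 'rV[R]_(d + d) :=
  row_mx (2^-1 *: (lsubmx p.1 + rsubmx p.1)) p.2.

Lemma at_strip_real x xi : at_strip b x 0 xi = symbol (row_mx x xi).
Proof. by rewrite /at_strip /symbol row_mx0. Qed.

(** The factor of the integrand other than the test function and the cutoff. *)
Definition weyl_phase (xi : 'rV[R]_d) : cfun R (d + d) := fun X =>
  cexp (imC R * (dotr (lsubmx X - rsubmx X) xi)%:C%C) * symbol (midpoint_arg (X, xi)).

Let measurable_pair_coord1 (k : 'I_(d + d)) : measurable_fun setT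
  (fun p : 'rV[R]_(d + d) * 'rV[R]_d => p.1 0 k : measurableTypeR R).
Proof. exact: (measurableT_comp (measurable_coord_rV k) measurable_fst). Qed.

Let measurable_pair_coord2 (k : 'I_d) : measurable_fun setT
  (fun p : 'rV[R]_(d + d) * 'rV[R]_d => p.2 0 k : measurableTypeR R).
Proof. exact: (measurableT_comp (measurable_coord_rV k) measurable_snd). Qed.

Lemma measurable_midpoint_arg : measurable_fun setT midpoint_arg.
Proof.
apply: measurable_fun_rV => k; rewrite /midpoint_arg.
under eq_fun do rewrite mxE; case: splitP => j _.
  under eq_fun do rewrite !mxE.
  apply: measurable_funM; first exact: measurable_cst.
  by apply: measurable_funD; exact: measurable_pair_coord1.
exact: measurable_pair_coord2.
Qed.

Lemma cmeasurable_weyl_phase :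
  cmeasurable (fun p : 'rV[R]_(d + d) * 'rV[R]_d => weyl_phase p.2 p.1).
Proof.
apply: cmeasurableM.
  apply: cmeasurable_cexp_imC; rewrite /dotr; apply: measurable_sum => k.
  apply: measurable_funM; last exact: measurable_pair_coord2.
  under eq_fun do rewrite !mxE.
  by apply: measurable_funB; exact: measurable_pair_coord1.
have -> : (fun p => symbol (midpoint_arg (p.1, p.2))) = symbol \o midpoint_arg.
  by apply/funext => -[].
apply: cmeasurable_comp measurable_midpoint_arg.
exact: continuous_cmeasurable.
Qed.

Lemma cmeasurable_weyl_phase1 xi : cmeasurable (weyl_phase xi).
Proof.
exact: (cmeasurable_comp cmeasurable_weyl_phase (measurable_pair2 xi)).
Qed.

(** The translation preserves [x + y], hence the argument of the symbol, and changes
    [x - y] by [2 t] in direction [i]. *)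
Lemma weyl_phase_shift (i : 'I_d) xi t X :
  weyl_phase xi (X + t *: (delta_mx 0 (lshift d i) - delta_mx 0 (rshift d i))) =
  cexp (imC R * (2 * xi 0 i * t)%:C%C) * weyl_phase xi X.
Proof.
rewrite /weyl_phase mulrA -cexp_imCD; congr (cexp (imC R * _%:C%C) * symbol _).
  rewrite /dotr (bigD1 i)//= [X in _ = _ + X](bigD1 i)//= addrA; congr (_ + _).
    by rewrite !mxE !eqxx eq_lrshift eq_rlshift /=; ring.
  apply: eq_bigr => k ki; rewrite !mxE eqxx /= !eq_lrshift !eq_rlshift.
  by rewrite eq_lshift eq_rshift (negbTE ki) /=; ring.
rewrite /midpoint_arg; congr (row_mx (_ *: _) _); apply/rowP => k.
rewrite !mxE eqxx /= !eq_lrshift !eq_rlshift eq_lshift eq_rshift.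
by case: (k == i); rewrite /=; ring.
Qed.

Lemma normr_midpoint (X : 'rV[R]_(d + d)) :
  `|2^-1 *: (lsubmx X + rsubmx X)| <= `|X|.
Proof.
apply/rV_norm_leP => // j; rewrite !mxE normrM ger0_norm ?invr_ge0//.
rewrite mulrC ler_pdivrMr// mulrDr mulr1 (le_trans (ler_normD _ _))//.
by rewrite lerD// normr_coord_le.
Qed.

Lemma normr_midpoint_arg (X : 'rV[R]_(d + d)) xi (r : R) : `|X| <= r -> `|xi| <= r ->
  `|midpoint_arg (X, xi)| <= r.
Proof.
move=> Xr xir; have r0 : 0 <= r := le_trans (normr_ge0 _) Xr.
apply/rV_norm_leP => // k; rewrite /midpoint_arg mxE; case: splitP => j _.
  by rewrite (le_trans (normr_coord_le _ _))// (le_trans (normr_midpoint X)).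
by rewrite (le_trans (normr_coord_le _ _)).
Qed.

Lemma modC_weyl_phase xi X : modC (weyl_phase xi X) = modC (symbol (midpoint_arg (X, xi))).
Proof. by rewrite /weyl_phase modCM modC_cexp_imC mul1r. Qed.

Definition fiber (f : cfun R (d + d)) : cfun R d := fun xi => pairing (weyl_phase xi) f.

Lemma cmeasurable_fiber f : continuous f -> cmeasurable (fiber f).
Proof.
move=> cf.
have h : cmeasurable (fun p : 'rV[R]_(d + d) * 'rV[R]_d => weyl_phase p.2 p.1 * f p.1).
  apply: cmeasurableM; first exact: cmeasurable_weyl_phase.
  exact: (cmeasurable_comp (continuous_cmeasurable cf) measurable_fst).
exact: (cmeasurable_cintegral_section (lebesgue_rV R (d + d)) h).
Qed.

(** From [(1 + s ^ 2) ^ d <= 2 ^ d (1 + s ^ (2 d))]: a bound and a moment of order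
    [2 d] suffice. *)
Let decay_of_moments (xi : 'rV[R]_d) (g K0 K1 : R) : 0 <= g -> g <= K0 ->
  `|xi| ^+ (d.*2) * g <= K1 -> g <= 2 ^+ d * (K0 + K1) * decay xi.
Proof.
move=> g0 gK0; set s := `|xi| => gK1; have s0 : 0 <= s := normr_ge0 _.
have K00 : 0 <= K0 := le_trans g0 gK0.
have K10 : 0 <= K1 by rewrite (le_trans _ gK1)// mulr_ge0 ?exprn_ge0.
have dec : (1 + s ^+ 2) ^- d <= decay xi.
  rewrite /decay -exprVn -[X in _ ^+ X]card_ord -prodr_const; apply: ler_prod => j _.
  rewrite invr_ge0 addr_ge0 ?sqr_ge0//= lef_pV2 ?posrE ?ltr_pwDl ?sqr_ge0//.
  rewrite lerD2l -[xi 0 j ^+ 2]real_normK ?num_real//.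
  by rewrite lerXn2r ?nnegrE//; exact: normr_coord_le.
rewrite (@le_trans _ _ (2 ^+ d * (K0 + K1) * (1 + s ^+ 2) ^- d))//; last first.
  by rewrite ler_wpM2l// mulr_ge0 ?exprn_ge0 ?addr_ge0.
have pos : 0 < (1 + s ^+ 2) ^+ d by rewrite exprn_gt0// ltr_pwDl ?sqr_ge0.
rewrite ler_pdivlMr//.
have [s1|/ltW s1] := leP s 1.
  rewrite (@le_trans _ _ (K0 * 2 ^+ d))//.
    apply: ler_pM => //; first exact: ltW.
    rewrite lerXn2r ?nnegrE ?addr_ge0 ?sqr_ge0//.
    by rewrite (_ : 2 = 1 + 1)// lerD2l exprn_ile1.
  by rewrite mulrC ler_wpM2l ?exprn_ge0// lerDl.
rewrite (@le_trans _ _ (g * (2 ^+ d * s ^+ d.*2)))//.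
  rewrite ler_wpM2l// -mul2n exprM -exprMn lerXn2r ?nnegrE ?addr_ge0 ?mulr_ge0 ?sqr_ge0//.
  by rewrite mulrDl mul1r lerD2r expr_ge1.
by rewrite mulrCA ler_wpM2l ?exprn_ge0// mulrC (le_trans gK1)// lerDr.
Qed.

(** [pairing_decay] is applied in a coordinate where [`|xi|] is attained, with
    [eta = xi 0 i]. The constant depends on the cube and on [h], but not on the test
    function: the continuity of the kernel will follow from this uniformity. *)
Lemma fiber_decay (M : nat -> R) (h r : R) (Bnd : 'rV[R]_d -> R) : (0 < d)%N ->
  0 <= r -> (forall xi, 0 <= Bnd xi) ->
  (forall x xi, `|x| <= r + 2 -> modC (at_strip b x 0 xi) <= Bnd xi) ->
  tame M h Bnd ->
  exists2 K, 0 <= K & forall f N, 0 <= N -> smooth f -> vanishes_off (cube r) f ->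
    (forall al x, modC (Dmulti al f x) <= N * (h ^+ mlen al * M (mlen al))) ->
    forall xi, modC (fiber f xi) <= K * N * decay xi.
Proof.
move=> d0 r0 Bnd0 bB tameB.
have [D0 D00 hD0] := tameB 0%N; have [D1 D10 hD1] := tameB d.*2.
pose V := cube_volume (d + d) r.
have V0 : 0 <= V := cube_volume_ge0 _ _.
exists (2 ^+ d * (2 * V * D0 + 2 * V * D1)).
  by rewrite mulr_ge0 ?exprn_ge0// addr_ge0// !mulr_ge0.
move=> f N N0 sf f0 fN xi.
have [i xi_i] := rV_norm_attained xi d0.
have moment l D : (exists2 q, (xi = 0 -> q = 0%N) &
      Bnd xi * (h ^+ (q + l) * M (q + l)%N) <= D * `|xi| ^+ q) ->
    `|xi| ^+ l * modC (fiber f xi) <= 2 * V * D * N.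
  move=> [q xq hq].
  have ij : lshift d i != rshift d i by rewrite eq_lrshift.
  have := @pairing_decay R (d + d) (lshift d i) (rshift d i) (xi 0 i) r (Bnd xi)
    (weyl_phase xi) r0 (cmeasurable_weyl_phase1 xi)
    (fun t X => weyl_phase_shift i xi t X).
  have Abnd X : `|X| <= r + 2 -> modC (weyl_phase xi X) <= Bnd xi.
    move=> Xr; rewrite modC_weyl_phase -at_strip_real; apply: bB.
    exact: le_trans (normr_midpoint X) Xr.
  move=> /(_ Abnd f N h M sf f0 ij fN (q + l)%N); rewrite xi_i -/(fiber f xi) -/V.
  have [x0|x0] := eqVneq xi 0.
    rewrite (xq x0) add0n => /le_trans; apply.
    move: hq; rewrite (xq x0) expr0 mulr1 add0n => hq.
    rewrite (_ : 2 * _ = 2 * V * N * (Bnd xi * (h ^+ l * M l))); last by ring.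
    by rewrite (_ : 2 * V * D * N = 2 * V * N * D) ?ler_wpM2l ?mulr_ge0//; ring.
  have nx : 0 < `|xi| by rewrite normr_gt0.
  rewrite exprD -mulrA => H; rewrite -(ler_pM2l (exprn_gt0 q nx)) (le_trans H)//.
  rewrite (_ : 2 * _ = 2 * V * N * (Bnd xi * (h ^+ (q + l) * M (q + l)%N))); last by ring.
  rewrite (_ : _ * (2 * V * D * N) = 2 * V * N * (D * `|xi| ^+ q)); last by ring.
  by rewrite ler_wpM2l ?mulr_ge0.
have m0 := moment 0%N D0 (hD0 xi); have m1 := moment d.*2 D1 (hD1 xi).
rewrite expr0 mul1r in m0.
have := decay_of_moments (modC_ge0 (fiber f xi)) m0 m1.
by rewrite -mulrDl mulrA.
Qed.

End weyl_symbol.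

(** * The kernel as an oscillatory integral *)

Section weyl_kernel_functional.
Variables (R : realType) (d : nat) (b : 'rV[Cplx R]_(d + d) -> Cplx R).
Local Notation C := (Cplx R).
Hypothesis b_entire : entire b.
Local Notation fiber := (fiber b).
Implicit Types f g : cfun R (d + d).

(** What the kernel requires of a function: this class contains the test functions and
    is visibly stable under linear combinations, and the kernel is linear on it. *)
Definition admissible f : Prop := exists r,
  [/\ 0 <= r, continuous f, vanishes_off (cube r) f &
      exists K, forall xi, modC (fiber f xi) <= K * decay xi].

Definition weyl_kernel f : C :=
  (((2 * pi) ^+ d)^-1)%:C%C * cintegral (lebesgue_rV R d) (fiber f).

Let integrable_Kdecay K :
  (lebesgue_rV R d).-integrable setT (EFin \o (fun xi => K * decay xi)).
Proof. exact: (integrableZl measurableT K (integrable_decay R d)). Qed.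

Lemma cintegrable_fiber f : admissible f -> cintegrable (lebesgue_rV R d) (fiber f).
Proof.
move=> [r [_ cf _ [K hK]]].
exact: (cintegrable_dominated (cmeasurable_fiber b_entire cf) (integrable_Kdecay K) hK).
Qed.

Lemma vanishes_off_cubeW n (f : cfun R n) r s : r <= s ->
  vanishes_off (cube r) f -> vanishes_off (cube s) f.
Proof. by move=> rs f0 x xs; apply: f0 => xr; apply: xs; exact: le_trans rs. Qed.

Lemma weyl_phase_bounded r rho : exists2 Q, 0 <= Q &
  forall X xi, `|X| <= r -> `|xi| <= rho -> modC (weyl_phase b xi X) <= Q.
Proof.
have [Q Q0 hQ] := continuous_cube_bounded (Num.max r rho) (entire_trace_continuous b_entire).
exists Q => // X xi Xr xir; rewrite modC_weyl_phase; apply: hQ.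
by apply: normr_midpoint_arg; rewrite le_max ?Xr ?xir ?orbT.
Qed.

Lemma fiber_clin a c f g r xi : 0 <= r -> continuous f -> continuous g ->
  vanishes_off (cube r) f -> vanishes_off (cube r) g ->
  fiber (clin a c f g) xi = a * fiber f xi + c * fiber g xi.
Proof.
move=> r0 cf cg f0 g0; have [Q Q0 hQ] := weyl_phase_bounded (r + 2) `|xi|.
apply: (@pairing_clin R (d + d) r Q (weyl_phase b xi) r0
  (cmeasurable_weyl_phase1 b_entire xi)) => //.
by move=> X Xr; exact: hQ.
Qed.

Lemma admissible_clin a c f g : admissible f -> admissible g ->
  admissible (clin a c f g) /\
  weyl_kernel (clin a c f g) = a * weyl_kernel f + c * weyl_kernel g.
Proof.
move=> af ag; have fi := cintegrable_fiber af; have gi := cintegrable_fiber ag.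
have [r [r0 cf f0 [K hK]]] := af; have [s [s0 cg g0 [L hL]]] := ag.
have m0 : 0 <= Num.max r s by rewrite le_max r0.
have f0' : vanishes_off (cube (Num.max r s)) f.
  by apply: vanishes_off_cubeW f0; rewrite le_max lexx.
have g0' : vanishes_off (cube (Num.max r s)) g.
  by apply: vanishes_off_cubeW g0; rewrite le_max lexx orbT.
have E xi := fiber_clin a c xi m0 cf cg f0' g0'.
split.
  exists (Num.max r s); split; [exact: m0|exact: (continuous_clin cf cg)| |].
    by move=> x hx; rewrite /clin (f0' x hx) (g0' x hx) !mulr0 addr0.
  exists (modC a * K + modC c * L) => xi; rewrite E.
  rewrite (le_trans (le_modCD _ _))// !modCM mulrDl -!mulrA.
  by rewrite lerD// ler_wpM2l ?modC_ge0.
rewrite /weyl_kernel (funext E) (cintegralD (cintegrableZ a fi) (cintegrableZ c gi)).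
by rewrite (cintegralZ a fi) (cintegralZ c gi) mulrDr; congr (_ + _); rewrite mulrCA.
Qed.

Lemma modC_weyl_kernel_le f K : continuous f ->
  (forall xi, modC (fiber f xi) <= K * decay xi) ->
  modC (weyl_kernel f) <=
  ((2 * pi) ^+ d)^-1 * (2 * Rintegral (lebesgue_rV R d) setT (@decay R d)) * K.
Proof.
move=> cf hK; rewrite /weyl_kernel modCM modCR ger0_norm; last first.
  by rewrite invr_ge0 exprn_ge0// mulr_ge0// pi_ge0.
rewrite -mulrA ler_wpM2l//; first by rewrite invr_ge0 exprn_ge0// mulr_ge0// pi_ge0.
have := modC_cintegral_le (cmeasurable_fiber b_entire cf) (integrable_Kdecay K) hK.
rewrite RintegralZl//; last exact: integrable_decay.
by rewrite -mulrA [K * _]mulrC.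
Qed.

Section oscillatory_limit.
Variables (f : cfun R (d + d)) (psi : cfun R d) (rho : R).
Hypotheses (af : admissible f) (cpsi : continuous psi) (rho0 : 0 <= rho).
Hypothesis psi0 : vanishes_off (cube rho) psi.
Hypothesis psi1 : \forall xi \near (0 : 'rV[R]_d), psi xi = 1.

Let osc_integrandE delta p : osc_integrand b f psi delta p =
  psi (delta *: p.2) * (weyl_phase b p.2 p.1 * f p.1).
Proof.
rewrite /osc_integrand at_strip_real hsubmxK /weyl_phase /midpoint_arg /=.
by ring.
Qed.

Let cmeasurable_psi delta : cmeasurable (fun xi : 'rV[R]_d => psi (delta *: xi)).
Proof.
apply: (cmeasurable_comp (continuous_cmeasurable cpsi)).
apply: measurable_fun_rV => i; under eq_fun do rewrite mxE.
by apply: measurable_funM; [exact: measurable_cst|exact: measurable_coord_rV].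
Qed.

Let cmeasurable_osc delta : cmeasurable (osc_integrand b f psi delta).
Proof.
have [r [r0 cf f0 _]] := af.
rewrite (funext (osc_integrandE delta)); apply: cmeasurableM.
  exact: (cmeasurable_comp (cmeasurable_psi delta) measurable_snd).
apply: cmeasurableM; first exact: (cmeasurable_weyl_phase b_entire).
exact: (cmeasurable_comp (continuous_cmeasurable cf) measurable_fst).
Qed.

Let psi_bounded : exists2 Q, 0 <= Q & forall xi, modC (psi xi) <= Q.
Proof. exact: (vanishes_off_bounded cpsi psi0). Qed.

Lemma cintegrable_osc_integrand delta : 0 < delta ->
  cintegrable (osc_measure R d) (osc_integrand b f psi delta).
Proof.
move=> delta0; have [r [r0 cf f0 _]] := af.
have [Qp Qp0 hQp] := psi_bounded.
have [Qf Qf0 hQf] := vanishes_off_bounded cf f0.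
have [Qw Qw0 hQw] := weyl_phase_bounded r (rho / delta).
have rd0 : 0 <= rho / delta by rewrite divr_ge0// ltW.
pose S : set ('rV[R]_(d + d) * 'rV[R]_d) := cube r `*` cube (rho / delta).
have mS : measurable S by apply: measurableX; exact: measurable_cube.
pose Q := Qp * (Qw * Qf).
have iS : (osc_measure R d).-integrable setT (EFin \o (fun p => Q * \1_S p)).
  apply: (integrableZl measurableT Q (f := fun x => (\1_S x)%:E)).
  apply/integrableP; split.
    by apply/measurable_EFinP; exact: measurable_indic.
  rewrite (eq_integral (fun x => (\1_S x)%:E)); last first.
    by move=> x _; rewrite gee0_abs// lee_fin.
  rewrite integral_indic// setIT /osc_measure /S.
  rewrite [ltLHS]product_measure1E; [|exact: measurable_cube..].
  apply: lte_mul_pinfty; first exact: measure_ge0.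
    by rewrite ge0_fin_numE; [exact: lebesgue_cube_lty|exact: measure_ge0].
  exact: lebesgue_cube_lty.
apply: (cintegrable_dominated (cmeasurable_osc delta) iS) => -[X xi].
rewrite osc_integrandE /=.
have [[XS xiS]|XS] := pselect (S (X, xi)).
  rewrite indicE mem_set// mulr1 modCM ler_pM ?modC_ge0//.
  by rewrite modCM ler_pM ?modC_ge0//; exact: hQw.
rewrite indicE memNset// mulr0.
have [Xr|Xr] := pselect (cube r X); last by rewrite (f0 _ Xr) !mulr0 modC0.
rewrite psi0 ?mul0r ?modC0// => h; apply: XS; split => //.
by move: h; rewrite /cube/= normrZ gtr0_norm// ler_pdivlMr// mulrC.
Qed.

(** For fixed [xi] the cutoff is a constant, which leaves the fibre integral. *)
Lemma cintegral_osc_integrand delta : 0 < delta ->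
  cintegral (osc_measure R d) (osc_integrand b f psi delta) =
  cintegral (lebesgue_rV R d) (fun xi => psi (delta *: xi) * fiber f xi).
Proof.
move=> delta0; have [r [r0 cf f0 _]] := af.
have wi xi : cintegrable (lebesgue_rV R (d + d)) (fun X => weyl_phase b xi X * f X).
  have [Q Q0 hQ] := weyl_phase_bounded (r + 2) `|xi|.
  apply: (@cintegrable_integrand R (d + d) r Q (weyl_phase b xi) r0
    (cmeasurable_weyl_phase1 b_entire xi)) => //.
  by move=> X Xr; exact: hQ.
have sec xi : (fun X => osc_integrand b f psi delta (X, xi)) =
    (fun X => psi (delta *: xi) * (weyl_phase b xi X * f X)).
  by apply/funext => X; rewrite osc_integrandE.
rewrite (@cintegral_fubini _ _ _ _ R (lebesgue_rV R (d + d)) (lebesgue_rV R d)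
  _ (cintegrable_osc_integrand delta0)).
  congr cintegral; apply/funext => xi; rewrite sec.
  exact: (cintegralZ _ (wi xi)).
by move=> xi; rewrite sec; exact: cintegrableZ.
Qed.

Let limit_along (u : nat -> R) : (forall k, 0 < u k) -> u @ \oo --> 0 ->
  (fun k => cintegral (lebesgue_rV R d) (fun xi => psi (u k *: xi) * fiber f xi)) @ \oo
  --> cintegral (lebesgue_rV R d) (fiber f).
Proof.
move=> u0 ucvg; have [r [r0 cf f0 [K hK]]] := af.
have [Qp Qp0 hQp] := psi_bounded.
apply: (cintegral_cvg (g := fun xi => (Qp * K) * decay xi)).
- by move=> k; apply: cmeasurableM; [exact: cmeasurable_psi|exact: cmeasurable_fiber].
- exact: integrable_Kdecay.
- by move=> k xi; rewrite modCM -mulrA ler_pM ?modC_ge0.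
move=> xi; apply: cvg_near_cst.
have /nbhs_ballP[e /= e0 he] := psi1.
have x1 : 0 < 1 + `|xi| by rewrite ltr_pwDl.
have /cvgrPdist_lt/(_ (e / (1 + `|xi|))) := ucvg.
rewrite divr_gt0// => /(_ isT); apply: filterS => k.
rewrite sub0r normrN gtr0_norm// ltr_pdivlMr// => uk.
rewrite he ?mul1r// mx_norm_ball /ball_/= sub0r normrN normrZ gtr0_norm//.
by rewrite (le_lt_trans _ uk)// ler_pM2l// lerDr.
Qed.

(** The fibre integral is absolutely integrable, so that dominated convergence removes
    the cutoffs, and the limit keeps no trace of [psi]. *)
Lemma osc_limit :
  (fun delta : R => (((2 * pi) ^+ d)^-1)%:C%C *
     cintegral (osc_measure R d) (osc_integrand b f psi delta)) @ 0^'+ --> weyl_kernel f.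
Proof.
set F := (X in X @ _ --> _).
have along (u : nat -> R) : (forall k, 0 < u k) -> u @ \oo --> 0 ->
    (fun k => F (u k)) @ \oo --> weyl_kernel f.
  move=> u0 ucvg.
  have -> : (fun k => F (u k)) = (fun k => (((2 * pi) ^+ d)^-1)%:C%C *
      cintegral (lebesgue_rV R d) (fun xi => psi (u k *: xi) * fiber f xi)).
    by apply/funext => k; rewrite /F cintegral_osc_integrand.
  have H := limit_along u0 ucvg.
  exact: (@cvgM _ _ _ _ _ _ _ _ (cvg_cst _) H).
apply: cvg_cplx.
  apply/cvg_at_rightP => u [u0 ucvg].
  exact: (@cvg_Re _ _ _ _ (fun k => F (u k)) _ (along u u0 ucvg)).
apply/cvg_at_rightP => u [u0 ucvg].
exact: (@cvg_Im _ _ _ _ (fun k => F (u k)) _ (along u u0 ucvg)).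
Qed.

End oscillatory_limit.

End weyl_kernel_functional.

(** * Test functions, growth and continuity *)

Section test_functions.
Variables (R : realType) (M : nat -> R) (n : nat).
Hypothesis M0 : forall p, 0 < M p.
Implicit Types (K : set 'rV[R]_n) (f g : cfun R n).

Lemma compact_closed_rV K : compact K -> closed K.
Proof. exact: (compact_closed (@norm_hausdorff _ _)). Qed.

Lemma closure_support_sub K f : closed K ->
  closure [set x | f x != 0] `<=` K <-> vanishes_off K f.
Proof.
move=> cK; split=> [fK x xK|f0].
  apply: contrapT => fx0; apply: xK; apply: fK; apply: subset_closure => /=.
  exact/eqP.
rewrite closureE => x; apply; split => // y /= fy0.
by apply: contrapT => /f0 fy; rewrite fy eqxx in fy0.
Qed.

Lemma compact_sub_cube K : compact K -> exists2 r, 0 <= r & K `<=` cube r.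
Proof.
move=> /compact_bounded[r [_ hr]]; exists (`|r| + 1); first by rewrite addr_ge0.
by move=> x /hr; apply; rewrite (le_lt_trans (ler_norm r))// ltrDl.
Qed.

Lemma vanishes_off_sub K (L : set 'rV[R]_n) f : K `<=` L ->
  vanishes_off K f -> vanishes_off L f.
Proof. by move=> KL f0 x Lx; apply: f0 => /KL. Qed.

Lemma vanishes_off_Dmulti K f (al : mindex n) : closed K -> vanishes_off K f ->
  vanishes_off K (Dmulti al f).
Proof.
move=> cK f0; rewrite /Dmulti; elim: (enum _) => [|j s IH]; first exact: f0.
exact: (vanishes_off_iter_Dj j (al j) cK IH).
Qed.

Lemma D_norm_lt K (h e : R) f : closed K -> 0 < h -> 0 <= e -> vanishes_off K f ->
  (D_norm M K h f < e%:E)%E ->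
  forall al x, modC (Dmulti al f x) <= e * (h ^+ mlen al * M (mlen al)).
Proof.
move=> cK h0 e0 f0 fe al x.
have hM : 0 < h ^+ mlen al * M (mlen al) by rewrite mulr_gt0// exprn_gt0.
have [Kx|Kx] := pselect (K x); last first.
  by rewrite (vanishes_off_Dmulti al cK f0 Kx) modC0 mulr_ge0// ltW.
rewrite -ler_pdivrMr// -lee_fin (le_trans _ (ltW fe))//.
apply: (@le_trans _ _ (ereal_sup
    [set (modC (Dmulti al f x) / (h ^+ mlen al * M (mlen al)))%:E | x in K])).
  by apply: ereal_sup_ubound; exists x.
by apply: ereal_sup_ubound; exists al.
Qed.

Lemma D_norm_le K (h e : R) f : 0 < h ->
  (forall al x, K x -> modC (Dmulti al f x) <= e * (h ^+ mlen al * M (mlen al))) ->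
  (D_norm M K h f <= e%:E)%E.
Proof.
move=> h0 fe; apply: ge_ereal_sup => _ [al _ <-]; apply: ge_ereal_sup => _ [x Kx <-].
by rewrite lee_fin ler_pdivrMr ?fe// mulr_gt0// exprn_gt0.
Qed.

Let lty_EFin (x : \bar R) : (x < +oo)%E -> exists2 N : R, 0 < N & (x < N%:E)%E.
Proof.
case: x => [x _|//|_]; last by exists 1 => //; exact: ltNyr.
exists (`|x| + 1); first by rewrite ltr_wpDl.
by rewrite lte_fin (le_lt_trans (ler_norm x))// ltrDl.
Qed.

Lemma D_step_finite K (h : R) f : closed K -> carrier (D_step M K h) f ->
  [/\ smooth f, vanishes_off K f & exists2 N, 0 < N & (D_norm M K h f < N%:E)%E].
Proof.
move=> cK [[sf /(closure_support_sub f cK) f0] /lty_EFin[N N0 fN]].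
by split; [exact: sf|exact: f0|exists N].
Qed.

Lemma D_step_carrier K (h e : R) f : closed K -> smooth f -> vanishes_off K f ->
  (D_norm M K h f <= e%:E)%E -> carrier (D_step M K h) f.
Proof.
move=> cK sf f0 fe; split; last exact: le_lt_trans fe (ltry _).
by split; [exact: sf|exact/(closure_support_sub f cK)].
Qed.

Lemma D_step_clin K (h1 h2 : R) a b f g : closed K -> 0 < h1 -> 0 < h2 ->
  carrier (D_step M K h1) f -> carrier (D_step M K h2) g ->
  carrier (D_step M K (Num.max h1 h2)) (clin a b f g).
Proof.
move=> cK h10 h20 /(D_step_finite cK)[sf f0 [N1 N10 fN]].
move=> /(D_step_finite cK)[sg g0 [N2 N20 gN]].
have H := D_norm_lt cK h10 (ltW N10) f0 fN.
have H' := D_norm_lt cK h20 (ltW N20) g0 gN.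
have m0 : 0 < Num.max h1 h2 by rewrite lt_max h10.
have cl0 : vanishes_off K (clin a b f g).
  by move=> x hx; rewrite /clin (f0 x hx) (g0 x hx) !mulr0 addr0.
apply: (@D_step_carrier K _ (modC a * N1 + modC b * N2) _ cK (smooth_clin a b sf sg) cl0).
have hmax k (h : R) : 0 < h -> h <= Num.max h1 h2 ->
    h ^+ k * M k <= Num.max h1 h2 ^+ k * M k.
  by move=> h0 hm; rewrite ler_wpM2r ?(ltW (M0 k))// lerXn2r ?nnegrE ?(ltW h0) ?(ltW m0).
apply: D_norm_le m0 _ => al x _; rewrite (Dmulti_clin a b al sf sg).
rewrite (le_trans (le_modCD _ _))// !modCM mulrDl -!mulrA lerD//.
  apply: ler_wpM2l; first exact: modC_ge0.
  apply: (le_trans (H al x)); apply: ler_wpM2l; first exact: ltW.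
  by apply: hmax => //; rewrite le_max lexx.
apply: ler_wpM2l; first exact: modC_ge0.
apply: (le_trans (H' al x)); apply: ler_wpM2l; first exact: ltW.
by apply: hmax => //; rewrite le_max lexx orbT.
Qed.

Lemma carrier_D_space reg f : carrier (D_space reg M n) f ->
  exists2 K, compact K & match reg with
  | Beurling => forall h, 0 < h -> carrier (D_step M K h) f
  | Roumieu => exists2 h, 0 < h & carrier (D_step M K h) f
  end.
Proof.
rewrite /D_space; by case: reg => -[K cK fK]; exists K.
Qed.

Lemma carrier_D_space_step reg f : carrier (D_space reg M n) f ->
  exists K h, [/\ compact K, 0 < h & carrier (D_step M K h) f].
Proof.
move=> /carrier_D_space[K cK]; case: reg => [fK|[h h0 fh]]; exists K.
  by exists 1; split => //; apply: fK.
by exists h.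
Qed.

Lemma D_space_support reg f : carrier (D_space reg M n) f ->
  continuous f /\ exists2 r, 0 <= r & vanishes_off (cube r) f.
Proof.
move=> /carrier_D_space_step[K [h [cK h0 /(D_step_finite (compact_closed_rV cK))]]].
move=> [sf f0 _]; split; first exact: smooth_continuous.
have [r r0 Kr] := compact_sub_cube cK.
by exists r; [exact: r0|exact: (vanishes_off_sub Kr f0)].
Qed.

End test_functions.

Section growth.
Variables (R : realType) (M : nat -> R) (d : nat).
Variable b : 'rV[Cplx R]_(d + d) -> Cplx R.
Hypotheses (hM : weight_sequence M) (d0 : (0 < d)%N).

Definition tame_bound (r h : R) (Bnd : 'rV[R]_d -> R) : Prop :=
  [/\ forall xi, 0 <= Bnd xi,
      forall x xi, `|x| <= r -> modC (at_strip b x 0 xi) <= Bnd xi &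
      tame M h Bnd].

Let enorm0 : enorm (0 : 'rV[R]_d) = 0.
Proof.
by rewrite /enorm big1 ?sqrtr0// => j _; rewrite mxE expr0n.
Qed.

Let enorm_ge0 (x : 'rV[R]_d) : 0 <= enorm x. Proof. exact: sqrtr_ge0. Qed.

(** In the Beurling case test functions are regular of every order [h], so that it
    suffices to find one [h] small enough for the given [m]. *)
Lemma growth_tame_Beurling r : growth_condition Beurling M b ->
  exists2 h, 0 < h & exists Bnd, tame_bound r h Bnd.
Proof.
move=> /(_ (cube r) (@compact_cube _ _ _))[rho rho0 [m [C1 [m0 C10 hb]]]].
have [M0 M1 _ [c0 [H [c01 H1 M2 _]]]] := hM.
have H0 : 0 < H := lt_le_trans ltr01 H1.
have md0 : 0 < m * d%:R by rewrite mulr_gt0// ltr0n.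
(* With this [h], c h H = 1 in [tame_of_series], where [c = m d]. *)
exists (m * d%:R * H)^-1; first by rewrite invr_gt0 mulr_gt0.
exists (fun xi => C1 * expR (assoc_fun M (m * enorm xi))); split.
- by move=> xi; rewrite mulr_ge0 ?expR_ge0// ltW.
- by move=> x xi xr; apply: hb => //; rewrite enorm0.
apply: (@tame_of_series R M (fun=> 1) d c0 H _ C1 (m * d%:R) 1) => //.
- exact: le_trans ler01 c01.
- exact: ltW.
- by rewrite invr_ge0 ltW// mulr_gt0.
- exact: ltW.
- exact: ltW.
- move=> q; rewrite mulr1.
  rewrite (_ : m * d%:R * (m * d%:R * H)^-1 * H = 1) ?expr1n//.
  by field; rewrite !gt_eqF// ltr0n.
- move=> xi; have t0 : 0 <= m * enorm xi by rewrite mulr_ge0// ltW.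
  have [q xq hq] := expR_assoc_fun_le M0 M1 t0.
  exists q; first by move=> x0; apply: xq; rewrite x0 enorm0 mulr0.
  exists (m * enorm xi).
    by rewrite t0 /= -mulrA ler_pM2l// enorm_le.
  by rewrite mulr1 ler_pM2l.
Qed.

(** In the Roumieu case [h] is imposed by the test function, and it is the growth of
    the partial products of [k] that absorbs it. *)
Lemma growth_tame_Roumieu r : growth_condition Roumieu M b ->
  exists Bnd, forall h, 0 < h -> tame_bound r h Bnd.
Proof.
move=> /(_ (cube r) (@compact_cube _ _ _))[rho rho0 [C1 [k [C10 kinf hb]]]].
have [M0 M1 _ [c0 [H [c01 H1 M2 _]]]] := hM.
have H0 : 0 < H := lt_le_trans ltr01 H1.
exists (fun xi => C1 * expR (assoc_fun_k M k (enorm xi))) => h h0; split.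
- by move=> xi; rewrite mulr_ge0 ?expR_ge0// ltW.
- by move=> x xi xr; apply: hb => //; rewrite enorm0.
have dhH : 0 <= d%:R * h * H by rewrite !mulr_ge0// ltW.
have [D D0 hD] := geometric_le_prod kinf dhH.
have P0 q : 0 < \prod_(1 <= j < q.+1) k j by have [k0 _ _] := kinf; apply: prodr_gt0.
apply: (@tame_of_series R M (fun q => \prod_(1 <= j < q.+1) k j) d c0 H _ C1 d%:R D) => //.
- exact: le_trans ler01 c01.
- exact: ltW.
- exact: ltW.
- exact: ltW.
- move=> xi.
  have [||q xq hq] := @expR_assoc_fun_le R
    (fun p => M p * \prod_(1 <= j < p.+1) k j) (enorm xi) _ _ (enorm_ge0 xi).
  + by move=> p; rewrite mulr_gt0.
  + by rewrite M1 big_geq// mulr1.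
  exists q; first by move=> x0; apply: xq; rewrite x0 enorm0.
  exists (enorm xi); first by rewrite enorm_ge0 enorm_le.
  by rewrite ler_pM2l.
Qed.

End growth.

Section kernel_continuity.
Variables (R : realType) (reg : regime) (M : nat -> R) (d : nat).
Variable b : 'rV[Cplx R]_(d + d) -> Cplx R.
Hypotheses (hd : (0 < d)%N) (hM : weight_sequence M) (b_entire : entire b).
Implicit Types (K : set 'rV[R]_(d + d)) (f : cfun R (d + d)).

Definition bounded_on_step K (h : R) : Prop := exists2 C, 0 <= C &
  forall f e, 0 < e -> carrier (D_step M K h) f -> (D_norm M K h f < e%:E)%E ->
    admissible b f /\ modC (weyl_kernel b f) <= C * e.

Lemma tame_bounded_on_step K r h Bnd : compact K -> 0 <= r -> K `<=` cube r ->
  0 < h -> tame_bound M b (r + 2) h Bnd -> bounded_on_step K h.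
Proof.
move=> cK r0 Kr h0 [B0 bB tB]; have [M0 _ _ _] := hM.
have [C C0 hC] := fiber_decay b_entire hd r0 B0 bB tB.
pose c := ((2 * pi) ^+ d)^-1 * (2 * Rintegral (lebesgue_rV R d) setT (@decay R d)).
have c0 : 0 <= c.
  rewrite mulr_ge0 ?invr_ge0 ?exprn_ge0 ?mulr_ge0 ?pi_ge0//.
  by apply: Rintegral_ge0 => x _; rewrite ltW// decay_gt0.
exists (c * C); first exact: mulr_ge0.
move=> f e e0 /(D_step_finite (compact_closed_rV cK))[sf f0 _] fe.
have fr := vanishes_off_sub Kr f0.
have bnd := D_norm_lt M0 (compact_closed_rV cK) h0 (ltW e0) f0 fe.
have H := hC f e (ltW e0) sf fr bnd.
split.
  by exists r; split; [exact: r0|exact: smooth_continuous|exact: fr|exists (C * e)].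
have := modC_weyl_kernel_le b_entire (smooth_continuous sf) H.
by rewrite -/c mulrA.
Qed.

Hypothesis b_growth : growth_condition reg M b.

Lemma weyl_kernel_bounded_on_step K : compact K ->
  match reg with
  | Beurling => exists2 h, 0 < h & bounded_on_step K h
  | Roumieu => forall h, 0 < h -> bounded_on_step K h
  end.
Proof.
move=> cK; have [r r0 Kr] := compact_sub_cube cK.
move: b_growth; case: reg => bg.
  have [h h0 [Bnd tB]] := growth_tame_Beurling hM hd (r + 2) bg.
  by exists h => //; exact: (tame_bounded_on_step cK r0 Kr h0 tB).
have [Bnd tB] := growth_tame_Roumieu hM (r + 2) bg.
by move=> h h0; exact: (tame_bounded_on_step cK r0 Kr h0 (tB h h0)).
Qed.

Lemma D_space_admissible f : carrier (D_space reg M (d + d)) f -> admissible b f.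
Proof.
move=> /carrier_D_space[K cK]; have := weyl_kernel_bounded_on_step cK.
have cl := compact_closed_rV cK.
case: reg => [[h h0 [C _ hC]] /(_ h h0) fK|hK [h h0 fK]].
  by have [_ _ [N N0 fN]] := D_step_finite cl fK; have [] := hC f N N0 fK fN.
have [C _ hC] := hK h h0.
by have [_ _ [N N0 fN]] := D_step_finite cl fK; have [] := hC f N N0 fK fN.
Qed.

Lemma weyl_kernel_osc_integral f : carrier (D_space reg M (d + d)) f ->
  osc_integral reg M b f (weyl_kernel b f).
Proof.
move=> /D_space_admissible af psi /(@D_space_support R M d reg).
move=> [cpsi [rho rho0 psi0]] psi1.
split; last exact: (osc_limit b_entire af cpsi rho0 psi0 psi1).
by move=> delta delta0; exact: (cintegrable_osc_integrand b_entire af cpsi rho0 psi0).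
Qed.

Let modC_convex (u v a c : Cplx R) (e : R) :
  modC u < e -> modC v < e -> modC a + modC c <= 1 -> modC (a * u + c * v) < e.
Proof.
move=> ue ve ac1; rewrite (le_lt_trans (le_modCD _ _))// !modCM.
pose m := Num.max (modC u) (modC v).
have me : m < e by rewrite gt_max ue ve.
have m0 : 0 <= m by rewrite le_max modC_ge0.
apply: (@le_lt_trans _ _ ((modC a + modC c) * m)).
  by rewrite mulrDl lerD// ler_wpM2l ?modC_ge0// le_max lexx ?orbT.
by rewrite (le_lt_trans _ me)// ler_piMl.
Qed.

(** The neighbourhoods of an inductive limit are tested on absolutely convex sets;
    [E] is everything for the limit over the compact sets and the union of the steps
    for the inner limit of the Roumieu case. *)
Let abs_convex_kernel_ball (E : set (cfun R (d + d))) (e : R) :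
  (forall a c f g, E f -> E g -> E (clin a c f g)) ->
  abs_convex [set f | [/\ E f, admissible b f & modC (weyl_kernel b f) < e]].
Proof.
move=> Elin f g a c [Ef af fe] [Eg ag ge] ac1.
have [acl El] := admissible_clin b_entire a c af ag.
split; [exact: Elin|exact: acl|rewrite -/(clin a c f g) El].
exact: modC_convex.
Qed.

Let kernel_small K h e : 0 < e -> bounded_on_step K h -> exists2 e', 0 < e' &
  forall f, carrier (D_step M K h) f -> (D_norm M K h f < e'%:E)%E ->
    admissible b f /\ modC (weyl_kernel b f) < e.
Proof.
move=> e0 [C C0 hC]; have C10 : 0 < C + 1 by rewrite ltr_wpDl.
have e'0 : 0 < e / (C + 1) by rewrite divr_gt0.
exists (e / (C + 1)) => // f fK fe; have [af le] := hC f _ e'0 fK fe; split => //.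
by rewrite (le_lt_trans le)// mulrA ltr_pdivrMr// mulrC ltr_pM2l// ltrDl.
Qed.

(** Over a fixed compact set, one step of the projective limit controls the kernel in
    the Beurling case, and every step of the inductive limit does in the Roumieu
    case. *)
Lemma weyl_kernel_ultradistribution : ultradistribution reg M (weyl_kernel b).
Proof.
split.
  move=> f g a /D_space_admissible af /D_space_admissible ag.
  have [_] := admissible_clin b_entire a 1 af ag.
  rewrite mul1r => <-; congr weyl_kernel.
  by apply/funext => x; rewrite /clin mul1r.
move=> e e0.
exists [set f | [/\ True, admissible b f & modC (weyl_kernel b f) < e]]; split.
- exact: (abs_convex_kernel_ball (fun _ _ _ _ _ _ => I)).
- by move=> f [].
move=> K cK; have := weyl_kernel_bounded_on_step cK.
case: reg => [[h h0 hK]|hK].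
  have [e' e'0 small] := kernel_small e0 hK.
  exists [:: h], (fun i => [set f | (D_norm M K i f < e'%:E)%E]); split.
    by move=> i; rewrite inE => /eqP ->; split => //; exists e'.
  move=> f fK /(_ h (mem_head _ _)) fe; have [af fle] := small f (fK h h0) fe.
  by split; [split|exact: fK].
have cl := compact_closed_rV cK; have [M0 _ _ _] := hM.
pose E : set (cfun R (d + d)) := \bigcup_(h in [set h | 0 < h]) carrier (D_step M K h).
exists [set f | [/\ E f, admissible b f & modC (weyl_kernel b f) < e]]; split.
- apply: abs_convex_kernel_ball => a c f g [h1 h10 fh] [h2 h20 gh].
  exists (Num.max h1 h2); first by rewrite /= lt_max h10.
  exact: D_step_clin.
- by move=> f [Ef af fe]; split.
move=> h h0; have [e' e'0 small] := kernel_small e0 (hK h h0).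
exists e' => // f Af fe.
have fK : carrier (D_step M K h) f.
  by split; [exact: Af|exact: lt_trans fe (ltry _)].
have [af fle] := small f fK fe.
by split; [split; [exists h|exact: af|exact: fle]|exact: fK].
Qed.

End kernel_continuity.

Theorem theorem6p1 (R : realType) (reg : regime) (M : nat -> R) (d : nat)
    (hd : (0 < d)%N) (hM : weight_sequence M)
    (a : cfun R (d + d) -> Cplx R) (ha : Bm1_space reg M a)
    (g : cfun R (d + d)) (hg : gauss_convolution reg M a g)
    (b : 'rV[Cplx R]_(d + d) -> Cplx R) (b_entire : entire b)
    (hb : forall X : 'rV[R]_(d + d), b (cvec X 0) = ((pi ^+ d)^-1)%:C%C * g X)
    (b_growth : growth_condition reg M b) :
  exists2 Kb : cfun R (d + d) -> Cplx R,
    forall chi : cfun R (d + d), carrier (D_space reg M (d + d)) chi ->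
      osc_integral reg M b chi (Kb chi) &
    ultradistribution reg M Kb.
Proof.
exists (weyl_kernel b) => [chi chiD|].
  exact: weyl_kernel_osc_integral.
exact: weyl_kernel_ultradistribution.
Qed.
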